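(* Let $j>0$, $u\in L^\infty([0,1],\mathbb R_+)$ with $F(0;u)>0$, let $\delta>0$ with $j\delta<F(0;u)$ and let $\delta'=\delta/k$ with $k$ a positive integer. Then for every $m\in\mathbb N$ $$S^{(\delta,-)}_{m\delta}(u)\le S^{(\delta',-)}_{m\delta}(u)\le S^{(\delta',+)}_{m\delta}(u)\le S^{(\delta,+)}_{m\delta}(u).$$ Moreover, the maps $K^{(\delta)}$, $G^{\rm neum}_t*$ and $S^{(\delta,\pm)}_t$ preserve the order on $\mathcal U_\delta$ (i.e. $u\le v$ implies the same inequality between their images).
   Context: For a positive measure $\mu$ on $[0,1]$, $F(r;\mu)=\mu([r,1])$. $\mathcal U$ = measures $c_uD_0+\rho_u(r)dr$ with $c_u\ge0$, $\rho_u\in L^\infty([0,1],\mathbb R_+)$, $D_0$ the Dirac mass at $0$; $u\le v$ iff $F(r;u)\le F(r;v)$ for all $r\in[0,1]$. $\mathcal U_\delta=\{u\in\mathcal U:F(0;\rho_u)>j\delta\}$; $K^{(\delta)}u=j\delta D_0+\mathbf 1_{[0,R_\delta(u)]}u$ with $R_\delta(u)=\inf\{r:F(r;u)=j\delta\}$. $G^{\rm neum}_t(r,r')$ is the heat kernel of $\partial_t=\frac12\partial_r^2$ on $[0,1]$ with Neumann boundary conditions ($\sum_kG_t(r,r'_k)$, $G_t(r,r')=e^{-(r-r')^2/2t}/\sqrt{2\pi t}$, $r'_k$ the images of $r'$ under repeated reflections of $[0,1]$) and $G^{\rm neum}_t*\mu(r)=\int G^{\rm neum}_t(r,r')\mu(dr')$.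 Barriers: $S^{(\delta,\pm)}_0(u)=u$, $S^{(\delta,-)}_{n\delta}(u)=K^{(\delta)}G^{\rm neum}_\delta*S^{(\delta,-)}_{(n-1)\delta}(u)$, $S^{(\delta,+)}_{n\delta}(u)=G^{\rm neum}_\delta*K^{(\delta)}S^{(\delta,+)}_{(n-1)\delta}(u)$. *)

(* Defs.v *)
From mathcomp Require Import all_boot all_order all_algebra.
From mathcomp Require Import all_classical all_reals all_analysis.
Set Implicit Arguments. Unset Strict Implicit. Unset Printing Implicit Defensive.
Import Order.TTheory GRing.Theory Num.Theory.
Import numFieldNormedType.Exports.
Local Open Scope classical_set_scope.
Local Open Scope ring_scope.

Section Defs.
Variable R : realType.

(* A measure  c D_0 + rho(r) dr  on [0,1], represented by the pair (c, rho). *)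
Record mes := Mes { mc : R; mrho : R -> R }.

Definition leb := (@lebesgue_measure R).

(* membership in the class U: c >= 0, rho a (representative of an)
   element of L^oo([0,1], R_+) *)
Definition inU (u : mes) : Prop :=
  0 <= mc u /\ measurable_fun (`[0%R, 1%R] : set R) (mrho u) /\
  (forall r, 0 <= r <= 1 -> 0 <= mrho u r) /\
  exists M : R, forall r, 0 <= r <= 1 -> `|mrho u r| <= M.

Definition Fd (r : R) (rho : R -> R) : R := \int[leb]_(x in `[r, 1%R]) rho x.

(* F(r; u) = u([r,1]) = c 1_{r = 0} + int_r^1 rho *)
Definition F (r : R) (u : mes) : R :=
  (if r == 0 then mc u else 0) + Fd r (mrho u).

Definition mle (u v : mes) : Prop := forall r, 0 <= r <= 1 -> F r u <= F r v.

Definition inUd (j d : R) (u : mes) : Prop := inU u /\ j * d < Fd 0 (mrho u).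

Definition Rd (j d : R) (u : mes) : R :=
  inf [set r | 0 <= r <= 1 /\ F r u = j * d].

Definition Kd (j d : R) (u : mes) : mes :=
  Mes (j * d + mc u) (fun r => if r <= Rd j d u then mrho u r else 0).

Definition G (t r r' : R) : R :=
  expR (- ((r - r') ^+ 2) / (2 * t)) / Num.sqrt (2 * pi * t).

(* Images of r' under the reflections of [0,1]: 2k + r' and 2k - r', k in Z.
   The term n groups the images for k = n and k = -(n+1). *)
Definition Gneum_term (t r r' : R) (n : nat) : R :=
  G t r (r' + 2 * n%:R) + G t r (2 * n%:R - r')
  + G t r (r' - 2 * n.+1%:R) + G t r (- r' - 2 * n.+1%:R).

Definition Gneum (t r r' : R) : R := limn (series (Gneum_term t r r')).

(* G^neum_t * mu : the measure with density r |-> int G^neum_t(r,r') mu(dr') *)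
Definition Gconv (t : R) (u : mes) : mes :=
  Mes 0 (fun r => mc u * Gneum t r 0 +
                  \int[leb]_(r' in `[0%R, 1%R]) (Gneum t r r' * mrho u r')).

(* barriers: S^(delta,-)_{n delta} and S^(delta,+)_{n delta} *)
Definition Sminus (j d : R) (n : nat) (u : mes) : mes :=
  iter n (fun v => Kd j d (Gconv d v)) u.
Definition Splus (j d : R) (n : nat) (u : mes) : mes :=
  iter n (fun v => Gconv d (Kd j d v)) u.

End Defs.

(* Main.v *)
Require Import Defs.
From mathcomp Require Import all_boot all_order all_algebra.
From mathcomp Require Import all_classical all_reals all_analysis.
From mathcomp Require Import measurable_realfun ring lra.
Set Implicit Arguments. Unset Strict Implicit. Unset Printing Implicit Defensive.
Import Order.TTheory GRing.Theory Num.Theory.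
Import numFieldNormedType.Exports.
Local Open Scope classical_set_scope.
Local Open Scope ring_scope.

(** Write K_a for the cut of mass a = j delta and G_t for the Neumann heat flow.
   On distribution functions, F(r; K_a u) = max(F(r; u) - a, 0) for r > 0, with
   the total mass unchanged, so K_a is monotone and K_a K_b = K_(a+b); since the
   heat flow moves the mass a cut off by K_a by at most a, K_a G_t <= G_t K_a.
   With G_s G_t = G_(s+t), moving all the cuts of k fine steps to the last
   (resp. first) position gives K_(ka) G_(kt) <= (K_a G_t)^k and
   (G_t K_a)^k <= G_(kt) K_(ka), while (K_a G_t)^n <= (G_t K_a)^n.

   The kernel is p(x - y) + p(x + y), with p the 2-periodized Gaussian; unfolding
   a period onto the line reduces mass conservation and the semigroup law to the
   Gaussian ones. G_t preserves the order as soon as y |-> int_r^1 G_t(x, y) dx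
   is nondecreasing; its derivative is p(r - y) - p(r + y), which is nonnegative
   if p decreases on [0,1]. This is proved termwise for t <= 1/128 only, where
   each image is dominated by a share of the central Gaussian, and large times
   follow from the semigroup law. *)

(** * Lebesgue integrals on the line *)

Section Lebesgue.
Variable R : realType.
Local Notation mu := (@lebesgue_measure R).
Local Open Scope ereal_scope.
Implicit Types (f : R -> \bar R).

(** Both measures agree on half-open intervals, and this determines Lebesgue measure. *)
Lemma lebesgue_measure_translate (c : R) (A : set R) : measurable A ->
  pushforward mu ((fun x => x + c)%R : _ -> measurableTypeR R) A = mu A.
Proof.
move=> mA; apply/esym/lebesgue_measure_unique => //=.
  by apply: measurable_funD.
move=> _ _ [[a b]] _ <-.
rewrite /pushforward.
rewrite (_ : (fun x => x + c)%R @^-1` `]a, b] = `]a - c, b - c]%classic)%R; last first.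
  by apply/seteqP; split => x /=; rewrite !in_itv/= ltrBlDr lerBrDr.
rewrite !lebesgue_measure_itv/= !lte_fin ltrD2r.
by case: ifPn => // _; rewrite -!EFinD; congr EFin; ring.
Qed.

Lemma ge0_integral_translate (c : R) (D : set R) f : measurable D ->
  measurable_fun setT f -> (forall x, 0 <= f x) ->
  \int[mu]_(x in (fun x => x + c)%R @^-1` D) f (x + c)%R = \int[mu]_(x in D) f x.
Proof.
move=> mD mf f0.
pose s : measurableTypeR R -> measurableTypeR R := fun x => (x + c)%R.
have ms : measurable_fun setT s by apply: measurable_funD.
transitivity (\int[mu]_(x in s @^-1` D) (f \o s) x) => //.
rewrite -(ge0_integral_pushforward ms)//=; last exact: measurable_funS mf.
by apply: eq_measure_integral => A mA _; exact: lebesgue_measure_translate.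
Qed.

Lemma ge0_integral_opp (D : set R) f : measurable D ->
  measurable_fun setT f -> (forall x, 0 <= f x) ->
  \int[mu]_(x in -%R @^-1` D) f (- x)%R = \int[mu]_(x in D) f x.
Proof.
move=> mD mf f0.
rewrite (_ : _ @^-1` D = (-%R : _ -> measurableTypeR R) @^-1` D)//.
rewrite -ge0_integral_pushforward//=; last exact: measurable_funS mf.
by apply: eq_measure_integral => //= A mA _; exact: lebesgue_measureN.
Qed.

Lemma ge0_integral_itv_translate (c a b : R) f :
  measurable_fun setT f -> (forall x, 0 <= f x) ->
  \int[mu]_(x in `[a, b]) f (x + c)%R = \int[mu]_(x in `[(a + c)%R, (b + c)%R]) f x.
Proof.
move=> mf f0; rewrite -[RHS](@ge0_integral_translate c)//.
rewrite (_ : _ @^-1` _ = `[a, b]%classic)//.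
by apply/seteqP; split => x /=; rewrite !in_itv/=; lra.
Qed.

Lemma ge0_integral_itv_opp (a b : R) f :
  measurable_fun setT f -> (forall x, 0 <= f x) ->
  \int[mu]_(x in `[a, b]) f (- x)%R = \int[mu]_(x in `[(- b)%R, (- a)%R]) f x.
Proof.
move=> mf f0; rewrite -[RHS]ge0_integral_opp//.
rewrite (_ : _ @^-1` _ = `[a, b]%classic)//.
by apply/seteqP; split => x /=; rewrite !in_itv/=; lra.
Qed.

Lemma ge0_integral_itv_split (a b c : R) f : (a <= b <= c)%R ->
  measurable_fun `[a, c] f -> (forall x, `[a, c]%classic x -> 0 <= f x) ->
  \int[mu]_(x in `[a, c]) f x =
  \int[mu]_(x in `[a, b]) f x + \int[mu]_(x in `[b, c]) f x.
Proof.
move=> /andP[ab bc] mf f0.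
have E : `[a, c]%classic = `[a, b]%classic `|` `]b, c]%classic.
  rewrite -(@itv_bndbnd_setU _ _ (BLeft a) (BRight b) (BRight c))//; rewrite bnd_simp//.
have m2 : measurable_fun `]b, c] f.
  apply: measurable_funS mf => // x /=; rewrite !in_itv/=; lra.
rewrite E in mf f0.
rewrite -[X in _ + X]integral_itv_obnd_cbnd// [in LHS]E ge0_integral_setU//.
apply/disj_setPS => x [/=]; rewrite !in_itv/= => /andP[_ xb] /andP[bx _].
  by have := lt_le_trans bx xb; rewrite ltxx.
Qed.

(** Tonelli on the whole plane, applied to [f] extended by zero outside the rectangle. *)
Lemma ge0_integral_exchange (A B : set R) (f : R * R -> \bar R) :
  measurable A -> measurable B ->
  measurable_fun setT f -> (forall z, 0 <= f z) ->
  \int[mu]_(x in A) \int[mu]_(y in B) f (x, y) =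
  \int[mu]_(y in B) \int[mu]_(x in A) f (x, y).
Proof.
move=> mA mB mf f0.
pose g := f \_ (A `*` B).
have mg : measurable_fun setT g.
  apply/(measurable_restrictT f); first exact: measurableX.
  exact: measurable_funS mf.
have g0 z : 0 <= g z by apply: erestrict_ge0.
have gE x y : g (x, y) = ((fun y => f (x, y)) \_ B) y * (\1_A x)%:E.
  rewrite /g !patchE indicE in_setX/=.
  by case: (x \in A); case: (y \in B); rewrite ?mule1 ?mule0 ?mul0e.
have gE' x y : g (x, y) = ((fun x => f (x, y)) \_ A) x * (\1_B y)%:E.
  rewrite /g !patchE indicE in_setX/=.
  by case: (x \in A); case: (y \in B); rewrite ?mule1 ?mule0 ?mul0e.
transitivity (\int[mu]_x \int[mu]_y g (x, y)).
  rewrite integral_mkcond; apply: eq_integral => x _.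
  rewrite patchE; case: ifPn => xA.
    rewrite integral_mkcond; apply: eq_integral => y _.
    by rewrite gE indicE xA mule1.
  rewrite (eq_integral (cst 0)) ?integral0// => y _.
  by rewrite gE indicE (negbTE xA) mule0.
transitivity (\int[mu]_y \int[mu]_x g (x, y)).
  exact: (fubini_tonelli (m1 := mu) (m2 := mu) g mg g0).
rewrite [RHS]integral_mkcond; apply: eq_integral => y _.
rewrite patchE; case: ifPn => yB.
  rewrite [RHS]integral_mkcond; apply: eq_integral => x _.
  by rewrite gE' indicE yB mule1.
rewrite (eq_integral (cst 0)) ?integral0// => x _.
by rewrite gE' indicE (negbTE yB) mule0.
Qed.

Lemma measurable_fun_ge0_integral (B : set R) (f : R * R -> \bar R) :
  measurable B -> measurable_fun setT f -> (forall z, 0 <= f z) ->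
  measurable_fun setT (fun x => \int[mu]_(y in B) f (x, y)).
Proof.
move=> mB mf f0.
have mg : measurable_fun setT (f \_ (setT `*` B)).
  apply/(measurable_restrictT f); first exact: measurableX.
  exact: measurable_funS mf.
apply: eq_measurable_fun (measurable_fun_fubini_tonelli_F (m2:=mu) _ mg _); last first.
  by move=> z; apply: erestrict_ge0.
move=> x _; rewrite /fubini_F [RHS]integral_mkcond; apply: eq_integral => y _.
by rewrite !patchE in_setX/= in_setT.
Qed.

End Lebesgue.

(** * The periodized Gaussian *)

Section Gauss.
Variable R : realType.
Local Notation mu := (@lebesgue_measure R).

Definition gauss (t z : R) : R := expR (- (z ^+ 2) / (2 * t)) / Num.sqrt (2 * pi * t).

Lemma gauss_ge0 t z : 0 <= gauss t z.
Proof. by rewrite divr_ge0 ?expR_ge0 ?sqrtr_ge0. Qed.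

Lemma gaussN t z : gauss t (- z) = gauss t z.
Proof. by rewrite /gauss sqrrN. Qed.

Lemma measurable_gauss t : measurable_fun setT (gauss t).
Proof.
apply: measurable_funM => //; apply: measurableT_comp => //.
by apply: measurable_funM => //; apply: measurable_funN; exact: measurable_funX.
Qed.

Lemma gauss_normal_pdf t m x : 0 < t ->
  gauss t (x - m) = normal_pdf m (Num.sqrt t) x.
Proof.
move=> t0; rewrite normal_pdfE ?gt_eqF ?sqrtr_gt0//.
rewrite /normal_peak /normal_fun /gauss sqr_sqrtr ?ltW// mulrC.
by congr (_ * expR (_ / _)); [congr (_^-1); congr Num.sqrt|]; ring.
Qed.

Lemma integral_gauss t m : 0 < t ->
  (\int[mu]_x (gauss t (x - m))%:E = 1)%E.
Proof.
move=> t0; under eq_integral do rewrite gauss_normal_pdf//.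
exact: integral_normal_pdf.
Qed.

(** Completing the square in [z]: one factor is constant in [z], the other is a Gaussian centred at
    a weighted mean of [x] and [y]. *)
Lemma gauss_mul s t x y z : 0 < s -> 0 < t ->
  gauss s (x - z) * gauss t (z - y) =
  gauss (s + t) (x - y) * gauss (s * t / (s + t)) (z - (t * x + s * y) / (s + t)).
Proof.
move=> s0 t0; have st0 : 0 < s + t by rewrite addr_gt0.
rewrite /gauss ![_ / _ * (_ / _)]mulf_div -!expRD -!sqrtrM; last 2 first.
  by rewrite !mulr_ge0 ?pi_ge0// ltW.
  by rewrite !mulr_ge0 ?pi_ge0// ltW.
congr (expR _ / Num.sqrt _); field; rewrite ?gt_eqF//.
Qed.

Lemma gauss_conv s t x y : 0 < s -> 0 < t ->
  (\int[mu]_z (gauss s (x - z) * gauss t (z - y))%:E = (gauss (s + t) (x - y))%:E)%E.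
Proof.
move=> s0 t0; have st0 : 0 < s + t by rewrite addr_gt0.
under eq_integral do rewrite gauss_mul// EFinM.
rewrite ge0_integralZl//=.
- by rewrite integral_gauss ?mule1// divr_gt0// mulr_gt0.
- by apply/measurable_EFinP; apply: (measurableT_comp (measurable_gauss _)); exact: measurable_funB.
- by move=> z _; rewrite lee_fin gauss_ge0.
- by rewrite lee_fin gauss_ge0.
Qed.

(* From (a - 1)^2 >= 0 the exponent is at most affine in the distance, so the
   images contribute at most a geometric series. *)
Lemma gauss_le_exp t z a : 0 < t -> a ^+ 2 = z ^+ 2 ->
  gauss t z <= expR ((1 - 2 * a) / (2 * t)) / Num.sqrt (2 * pi * t).
Proof.
move=> t0 az; rewrite ler_wpM2r ?invr_ge0 ?sqrtr_ge0// ler_expR.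
rewrite ler_pM2r ?invr_gt0 ?mulr_gt0// -az.
have := sqr_ge0 (a - 1); rewrite sqrrB; lra.
Qed.

End Gauss.

Section PeriodizedGauss.
Variable R : realType.
Local Notation mu := (@lebesgue_measure R).
Local Open Scope ereal_scope.
Implicit Types (t x y z : R).

(* The n-th term groups the shifts by -2n and by 2(n+1), as in [Gneum_term]. *)
Definition pgauss t z : \bar R :=
  \sum_(n <oo) (gauss t (z - 2 * n%:R) + gauss t (z + 2 * n.+1%:R))%:E.

Let pterm_ge0 t z n : 0 <= (gauss t (z - 2 * n%:R) + gauss t (z + 2 * n.+1%:R))%:E.
Proof. by rewrite lee_fin addr_ge0// gauss_ge0. Qed.

Lemma pgauss_ge0 t z : 0 <= pgauss t z.
Proof. by apply: nneseries_ge0. Qed.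

Lemma measurable_gauss_shift t c : measurable_fun setT (fun z => (gauss t (z + c))).
Proof.
by apply: (measurableT_comp (measurable_gauss t)); exact: measurable_funD.
Qed.

Lemma measurable_pgauss t : measurable_fun setT (pgauss t).
Proof.
apply: ge0_emeasurable_sum => // n _; apply/measurable_EFinP.
by apply: measurable_funD; exact: measurable_gauss_shift.
Qed.

Let gE t z : 0 <= (gauss t z)%:E.
Proof. by rewrite lee_fin gauss_ge0. Qed.

Lemma pgaussE t z : pgauss t z =
  \sum_(n <oo) (gauss t (z - 2 * n%:R))%:E +
  \sum_(n <oo) (gauss t (z + 2 * n.+1%:R))%:E.
Proof.
by rewrite -nneseriesD//; apply: eq_eseriesr => n _; rewrite EFinD.
Qed.

(** Peeling off a first term realigns the two one-sided series of [pgaussE], whose indices differ by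
    one; every symmetry of [pgauss] below rests on this. *)
Lemma nneseries_gauss_recl t (f : nat -> R) :
  \sum_(n <oo) (gauss t (f n))%:E =
  (gauss t (f 0%N))%:E + \sum_(n <oo) (gauss t (f n.+1))%:E.
Proof.
rewrite nneseries_recl//; congr (_ + _).
rewrite -(nneseries_addn (f := fun n => (gauss t (f n))%:E) 1)//.
by apply: eq_eseriesr => n _; rewrite addn1.
Qed.

Lemma pgauss_periodic t z : pgauss t (z + 2) = pgauss t z.
Proof.
rewrite !pgaussE nneseries_gauss_recl [X in _ = _ + X]nneseries_gauss_recl.
rewrite [RHS]addeCA -addeA; congr (_ + (_ + _)).
- by congr (gauss _ _)%:E; ring.
- by apply: eq_eseriesr => n _; congr (gauss _ _)%:E; rewrite -natr1; ring.
- by apply: eq_eseriesr => n _; congr (gauss _ _)%:E; rewrite -!natr1; ring.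
Qed.

Lemma pgaussN t z : pgauss t (- z) = pgauss t z.
Proof.
rewrite !pgaussE nneseries_gauss_recl [in RHS]nneseries_gauss_recl.
rewrite -addeA -[RHS]addeA [X in _ + X]addeC.
have E (a b : R) : (a = - b)%R -> (gauss t a)%:E = (gauss t b)%:E by move=> ->; rewrite gaussN.
congr (_ + (_ + _)).
- by apply: E; ring.
- by apply: eq_eseriesr => n _; apply: E; ring.
- by apply: eq_eseriesr => n _; apply: E; ring.
Qed.

Lemma pgauss_bound t (M : R) : (0 < t)%R ->
  exists2 C : R, (0 <= C)%R & forall z, (- M <= z <= M)%R -> pgauss t z <= C%:E.
Proof.
(* Consecutive images are 2 apart, so the exponent in [gauss_le_exp] drops by 4/(2t) each time. The
   factor 2 in [c] counts the two images of a term. *)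
move=> t0; pose q := expR (- (4 / (2 * t))) : R.
have q1 : (`|q| < 1)%R.
  by rewrite ger0_norm ?expR_ge0// expR_lt1 oppr_lt0 divr_gt0// mulr_gt0.
pose c := (2 * (expR ((1 + 2 * M) / (2 * t)) / Num.sqrt (2 * pi * t)))%R : R.
have c0 : (0 <= c)%R by rewrite !mulr_ge0// ?expR_ge0// invr_ge0 sqrtr_ge0.
exists (c * (1 - q)^-1)%R.
  by rewrite mulr_ge0// invr_ge0 subr_ge0 ltW// (le_lt_trans (ler_norm _)).
move=> z /andP[z1 z2].
have H n : (gauss t (z - 2 * n%:R) + gauss t (z + 2 * n.+1%:R) <= geometric c q n)%R.
  have -> : geometric c q n = (expR ((1 + 2 * M) / (2 * t)) / Num.sqrt (2 * pi * t) * q ^+ n +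
      expR ((1 + 2 * M) / (2 * t)) / Num.sqrt (2 * pi * t) * q ^+ n)%R.
    by rewrite /geometric/= /c; ring.
  (* The Gaussian being even, an image may be read with either sign; [a] is the representative
     bounded below by 2n - M. *)
  have E (a b : R) : (a ^+ 2 = b ^+ 2)%R -> (2 * n%:R - M <= a)%R ->
      (gauss t b <= expR ((1 + 2 * M) / (2 * t)) / Num.sqrt (2 * pi * t) * q ^+ n)%R.
    move=> ab na; apply: (le_trans (gauss_le_exp t0 ab)).
    rewrite -[leRHS]mulrAC ler_wpM2r ?invr_ge0 ?sqrtr_ge0//.
    rewrite /q -expRM_natl -expRD ler_expR.
    have -> : ((1 + 2 * M) / (2 * t) + n%:R * - (4 / (2 * t)) = (1 + 2 * M - 4 * n%:R) / (2 * t))%R by field; rewrite gt_eqF.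
    by rewrite ler_pM2r ?invr_gt0 ?mulr_gt0//; lra.
  apply: lerD; [apply: (E (2 * n%:R - z)%R); [ring|lra]|].
  by apply: (E (z + 2 * n.+1%:R)%R) => //; rewrite -natr1; lra.
have cvgq := @cvg_geometric_series _ c q q1.
apply: (@le_trans _ _ (\sum_(n <oo) (geometric c q n)%:E)).
  by apply: lee_nneseries => // n _; rewrite lee_fin; exact: H.
rewrite (_ : (fun _ => _) = EFin \o series (geometric c q)).
  rewrite EFin_lim; last by apply/cvg_ex; eexists; exact: cvgq.
  by rewrite (cvg_lim _ cvgq).
by apply/funext => n; rewrite /= sumEFin.
Qed.

(* The real-valued series defining [Gneum] converges, hence its limit is not a
   junk value. *)
Lemma GneumE t x y : (0 < t)%R -> (0 <= x <= 1)%R -> (0 <= y <= 1)%R ->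
  (Gneum t x y)%:E = pgauss t (x - y) + pgauss t (x + y).
Proof.
move=> t0 x01 y01.
have S : pgauss t (x - y) + pgauss t (x + y) =
    \sum_(n <oo) (Gneum_term t x y n)%:E.
  rewrite /pgauss -nneseriesD//; apply: eq_eseriesr => n _.
  rewrite -EFinD; congr EFin.
  have GE a b : G t a b = gauss t (a - b) by [].
  (* Of the four images in a term, the two translates of [y] belong to [x - y] and the two
     translates of [- y] to [x + y]. *)
  rewrite /Gneum_term !GE addrACA -!addrA.
  by do ![congr (_ + _)%R|congr (gauss t _); ring].
have [C C0 HC] := pgauss_bound 2 t0.
have T0 n : (0 <= Gneum_term t x y n)%R.
  by rewrite /Gneum_term !addr_ge0//; exact: gauss_ge0.
rewrite S.
have E : (fun n => \sum_(0 <= i < n) (Gneum_term t x y i)%:E) =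
    EFin \o series (Gneum_term t x y).
  by apply/funext => n; rewrite /= sumEFin.
rewrite E EFin_lim//.
apply: nondecreasing_is_cvgn.
  by apply: nondecreasing_series => n _ _; exact: T0.
exists (C + C)%R => _ [n _ <-]; rewrite -lee_fin -sumEFin EFinD.
apply: (@le_trans _ _ (\sum_(i <oo) (Gneum_term t x y i)%:E)).
  by apply: nneseries_lim_ge => i _ _; rewrite lee_fin.
by rewrite -S leeD// HC//; lra.
Qed.

End PeriodizedGauss.

(** * Unfolding a period onto the line *)

Section Periodize.
Variable R : realType.
Local Notation mu := (@lebesgue_measure R).
Local Open Scope ereal_scope.

(** The translates of [-1,1] by even integers tile the line up to null sets, and the integrals over
    growing finite tilings converge monotonically. *)
Lemma integral_periodize (k : R -> \bar R) :
  measurable_fun setT k -> (forall z, 0 <= k z) ->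
  \int[mu]_(z in `[(-1)%R, 1%R]) (\sum_(n <oo) (k (z + 2 * n%:R)%R + k (z - 2 * n.+1%:R)%R)) =
  \int[mu]_z k z.
Proof.
move=> mk k0.
have mS c : measurable_fun setT (fun z : R => k (z + c)%R).
  by apply: measurableT_comp => //; exact: measurable_funD.
rewrite integral_nneseries//; last 2 first.
- by move=> n; apply: measurable_funS (emeasurable_funD (mS _) (mS _)).
- by move=> n z _; rewrite adde_ge0.
(* The union of the first [n] pairs of tiles: the pair of index i adds [2i-1, 2i+1] on the right and
   [-2i-3, -2i-1] on the left. [D 0] is a single point, which matches the empty sum. *)
pose D n : set R := [set` `[(- 1 - 2 * n%:R)%R, (2 * n%:R - 1)%R]].
have mkD (A : set R) : measurable A -> measurable_fun A k by move=> mA; exact: measurable_funS mk.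
have EI (a b a' b' : R) : a = a' -> b = b' ->
  \int[mu]_(z in `[a, b]) k z = \int[mu]_(z in `[a', b']) k z by move=> -> ->.
have split (a b c : R) : (a <= b <= c)%R -> \int[mu]_(z in `[a, c]) k z =
    \int[mu]_(z in `[a, b]) k z + \int[mu]_(z in `[b, c]) k z.
  by move=> abc; apply: ge0_integral_itv_split => //; exact: mkD.
have Eadd (a b c b' c' : \bar R) : b = b' -> c = c' -> a + (b + c) = (c' + a) + b'.
  by move=> -> ->; rewrite addeCA addeC [a + _]addeC.
have psum n : \sum_(0 <= i < n) \int[mu]_(z in `[(-1)%R, 1%R]) (k (z + 2 * i%:R)%R + k (z - 2 * i.+1%:R)%R)
    = \int[mu]_(z in D n) k z.
  elim: n => [|n IH].
    by rewrite big_geq// /D !mulr0 subr0 sub0r set_itv1 integral_set1.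
  rewrite big_nat_recr//= IH ge0_integralD//; last 2 first.
    by move: (mS (2 * n%:R)%R); exact: measurable_funS.
    by move: (mS (- (2 * n.+1%:R))%R); exact: measurable_funS.
  rewrite !ge0_integral_itv_translate//.
  have n0 : (0 <= n%:R :> R)%R by [].
  rewrite /D (split _ (2 * n%:R - 1)%R (2 * n.+1%:R - 1)%R); last by rewrite -natr1; lra.
  rewrite (split _ (- 1 - 2 * n%:R)%R (2 * n%:R - 1)%R); last by rewrite -natr1; lra.
  apply: Eadd; apply: EI; rewrite -!natr1; ring.
transitivity (limn (fun n => \int[mu]_(z in D n) k z)).
  by apply: congr_lim; apply/funext => n; exact: psum.
apply: cvg_lim => //.
rewrite (_ : [set: R] = \bigcup_n D n); last first.
  apply/esym; rewrite -subTset => z _; exists (Num.truncn `|z|).+1 => //=.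
  have /andP[_ h] := truncn_itv (normr_ge0 z); have T0 : (0 <= (Num.truncn `|z|)%:R :> R)%R by [].
  by rewrite /D /= in_itv/=; move: h; rewrite ltr_norml -!natr1; lra.
apply: ge0_nondecreasing_set_cvg_integral => //.
- apply/nondecreasing_seqP => n; apply/subsetPset => z; rewrite /D /= !in_itv/= -natr1; lra.
- by move=> n; exact: measurable_itv.
- by move=> n; apply: mkD; exact: measurable_itv.
Qed.

End Periodize.

(** * The real-valued periodic kernel and its semigroup law *)

Section PeriodicKernel.
Variable R : realType.
Local Notation mu := (@lebesgue_measure R).
Local Open Scope ereal_scope.
Implicit Types (s t x y z : R).

(** By [pgauss_fin], [fine] loses nothing for positive times. *)
Definition pg t z : R := fine (pgauss t z).

Lemma pgauss_fin t z : (0 < t)%R -> pgauss t z = (pg t z)%:E.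
Proof.
move=> t0; rewrite /pg fineK// ge0_fin_numE ?pgauss_ge0//.
have [C _ HC] := pgauss_bound `|z| t0.
by rewrite (le_lt_trans (HC z _)) ?ltry// -ler_norml.
Qed.

Lemma pg_ge0 t z : (0 <= pg t z)%R.
Proof. by rewrite fine_ge0// pgauss_ge0. Qed.

Lemma pgN t z : pg t (- z) = pg t z.
Proof. by rewrite /pg pgaussN. Qed.

Lemma pg_periodic t z : pg t (z + 2) = pg t z.
Proof. by rewrite /pg pgauss_periodic. Qed.

Lemma pg_bound t (M : R) : (0 < t)%R ->
  exists2 C : R, (0 <= C)%R & forall z, (- M <= z <= M -> pg t z <= C)%R.
Proof.
move=> t0; have [C C0 HC] := pgauss_bound M t0.
by exists C => // z /HC; rewrite pgauss_fin.
Qed.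

Lemma measurable_pg t : measurable_fun setT (pg t).
Proof. by apply: measurableT_comp => //; exact: measurable_pgauss. Qed.

Lemma measurable_pg_comp d (T : measurableType d) (f : T -> R) t :
  measurable_fun setT f -> measurable_fun setT (fun w => pg t (f w)).
Proof. by move=> mf; apply: (measurableT_comp (measurable_pg t)). Qed.

(** A 2-periodic [h] absorbs every even shift, so periodizing the product [gauss t (x - z) * h z]
    periodizes the Gaussian alone. *)
Lemma integral_pg_unfold t x (h : R -> R) : (0 < t)%R ->
  measurable_fun setT h -> (forall z, 0 <= h z)%R -> (forall z, h (z + 2) = h z)%R ->
  \int[mu]_(z in `[(-1)%R, 1%R]) (pg t (x - z) * h z)%:E =
  \int[mu]_z (gauss t (x - z) * h z)%:E.
Proof.
move=> t0 mh h0 hp.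
have hpn (n : nat) z : h (z + 2 * n%:R)%R = h z.
  elim: n => [|n IH]; first by rewrite mulr0 addr0.
  by rewrite -[in RHS]IH -[in RHS]hp; congr h; rewrite -natr1; ring.
have hpm (n : nat) z : h (z - 2 * n%:R)%R = h z.
  by rewrite -[LHS](hpn n) subrK.
rewrite -integral_periodize; last 2 first.
- apply/measurable_EFinP; apply: measurable_funM => //.
  by apply: (measurableT_comp (measurable_gauss _)); exact: measurable_funB.
- by move=> z; rewrite lee_fin mulr_ge0// gauss_ge0.
apply: eq_integral => z _; rewrite mulrC EFinM -pgauss_fin// /pgauss.
rewrite -nneseriesZl; last by move=> n _; rewrite lee_fin addr_ge0// gauss_ge0.
apply: eq_eseriesr => n _; rewrite hpn hpm -EFinD -EFinM; congr EFin.
by rewrite [LHS]mulrC [LHS]mulrDl; congr (gauss t _ * _ + gauss t _ * _)%R; ring.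
Qed.

Lemma integral_pg t x : (0 < t)%R ->
  \int[mu]_(z in `[(-1)%R, 1%R]) (pg t (x - z))%:E = 1.
Proof.
move=> t0; have := @integral_pg_unfold t x (cst 1%R) t0.
under eq_integral do rewrite mulr1.
move=> ->//; under eq_integral do rewrite mulr1 -gaussN opprB.
exact: integral_gauss.
Qed.

(** Only the first factor is unfolded. The second is then expanded into its images, each of which
    gives a Gaussian convolution on the line. *)
Lemma pg_conv s t x y : (0 < s)%R -> (0 < t)%R ->
  \int[mu]_(z in `[(-1)%R, 1%R]) (pg s (x - z) * pg t (z - y))%:E = (pg (s + t) (x - y))%:E.
Proof.
move=> s0 t0; have st0 : (0 < s + t)%R by rewrite addr_gt0.
rewrite (integral_pg_unfold _ s0 (h := fun z => pg t (z - y)))//; last 3 first.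
- by apply: measurable_pg_comp; exact: measurable_funB.
- by move=> z; exact: pg_ge0.
- by move=> z; rewrite -[RHS]pg_periodic; congr pg; ring.
have mg c : measurable_fun setT (fun z : R => gauss s (x - z) * gauss t (z - c))%R.
  apply: measurable_funM.
    by apply: (measurableT_comp (measurable_gauss _)); exact: measurable_funB.
  by apply: (measurableT_comp (measurable_gauss _)); exact: measurable_funB.
have g0 c z : (0 <= gauss s (x - z) * gauss t (z - c))%R by rewrite mulr_ge0// gauss_ge0.
transitivity (\int[mu]_z \sum_(n <oo)
   ((gauss s (x - z) * gauss t (z - (y + 2 * n%:R)))%:E +
    (gauss s (x - z) * gauss t (z - (y - 2 * n.+1%:R)))%:E)).
  apply: eq_integral => z _; rewrite EFinM -pgauss_fin// /pgauss.
  rewrite -nneseriesZl; last by move=> n _; rewrite lee_fin addr_ge0// gauss_ge0.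
  apply: eq_eseriesr => n _; rewrite -EFinD -EFinM; congr EFin.
  by rewrite [LHS]mulrDr; congr (_ * gauss t _ + _ * gauss t _)%R; ring.
rewrite integral_nneseries//; last 2 first.
- by move=> n; apply: emeasurable_funD; apply/measurable_EFinP; exact: mg.
- by move=> n z _; rewrite -EFinD lee_fin addr_ge0.
rewrite -pgauss_fin// /pgauss; apply: eq_eseriesr => n _.
rewrite ge0_integralD//; last 4 first.
- by move=> z _; rewrite lee_fin.
- by apply/measurable_EFinP; exact: mg.
- by move=> z _; rewrite lee_fin.
- by apply/measurable_EFinP; exact: mg.
rewrite !gauss_conv// -EFinD; congr (gauss _ _ + gauss _ _)%:E; ring.
Qed.

End PeriodicKernel.

(** * The Neumann kernel *)

Section NeumannKernel.
Variable R : realType.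
Local Notation mu := (@lebesgue_measure R).
Local Open Scope ereal_scope.
Implicit Types (r s t x y z : R).

(** Method of images: the orbit of [y] under the reflections consists of the even translates of [y]
    and of [- y]. This expression is measurable on the whole plane and agrees with [Gneum] on the
    unit square. *)
Definition nk t x y : R := (pg t (x - y) + pg t (x + y))%R.

Lemma Gneum_nk t x y : (0 < t)%R -> (0 <= x <= 1)%R -> (0 <= y <= 1)%R ->
  Gneum t x y = nk t x y.
Proof.
by move=> t0 x01 y01; apply: EFin_inj; rewrite GneumE// !pgauss_fin.
Qed.

Lemma nk_ge0 t x y : (0 <= nk t x y)%R.
Proof. by rewrite addr_ge0// pg_ge0. Qed.

Lemma measurable_nk t : measurable_fun setT (fun w : R * R => nk t w.1 w.2).
Proof.
by apply: measurable_funD; apply: measurable_pg_comp;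
  [exact: measurable_funB|exact: measurable_funD].
Qed.

Lemma measurable_nkl t y : measurable_fun setT (fun x : R => nk t x y).
Proof.
by apply: measurable_funD; apply: measurable_pg_comp;
  [exact: measurable_funB|exact: measurable_funD].
Qed.

Lemma measurable_nkr t x : measurable_fun setT (nk t x).
Proof.
by apply: measurable_funD; apply: measurable_pg_comp;
  [exact: measurable_funB|exact: measurable_funD].
Qed.

Lemma nk_bound t : (0 < t)%R -> exists2 C : R, (0 <= C)%R &
  forall x y, (0 <= x <= 1 -> 0 <= y <= 1 -> nk t x y <= C)%R.
Proof.
move=> t0; have [C C0 HC] := pg_bound 2 t0.
exists (C + C)%R; first by rewrite addr_ge0.
by move=> x y x01 y01; rewrite lerD// HC//; lra.
Qed.

(** Turns integrals of the Neumann kernel over [0,1] into integrals of the periodic kernel over a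
    full period. *)
Lemma integral_fold (f : R -> R) (b : R) : (0 <= b)%R ->
  measurable_fun setT f -> (forall z, 0 <= f z)%R ->
  \int[mu]_(z in `[0%R, b]) (f z + f (- z))%:E = \int[mu]_(z in `[(- b)%R, b]) (f z)%:E.
Proof.
move=> b0 mf f0; have mfe : measurable_fun setT (EFin \o f) by apply/measurable_EFinP.
have fe0 z : 0 <= (EFin \o f) z by rewrite lee_fin.
have mfN : measurable_fun setT (fun z => (EFin \o f) (- z)%R).
  by apply: (measurableT_comp mfe); exact: oppr_measurable.
under eq_integral do rewrite EFinD.
rewrite ge0_integralD//; last 4 first.
- by move=> z _; rewrite lee_fin.
- exact: measurable_funS mfe.
- by move=> z _; rewrite lee_fin.
- exact: measurable_funS mfN.
rewrite (ge0_integral_itv_opp _ _ mfe fe0) oppr0 [RHS](@ge0_integral_itv_split _ _ 0%R)//.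
- exact: addeC.
- by rewrite b0 oppr_le0 b0.
- exact: measurable_funS mfe.
- by move=> x _; rewrite lee_fin.
Qed.

Lemma integral_nk_mass t y : (0 < t)%R ->
  \int[mu]_(x in `[0%R, 1%R]) (nk t x y)%:E = 1.
Proof.
move=> t0.
have mf : measurable_fun setT (fun z => pg t (y - z)).
  by apply: measurable_pg_comp; exact: measurable_funB.
have F := integral_fold ler01 mf (fun z => pg_ge0 t (y - z)).
transitivity (\int[mu]_(z in `[(- 1)%R, 1%R]) (pg t (y - z))%:E); last exact: integral_pg.
transitivity (\int[mu]_(z in `[0%R, 1%R]) (pg t (y - z) + pg t (y - - z))%:E); last exact: F.
apply: eq_integral => z _; rewrite /nk -pgN; congr (pg t _ + pg t _)%:E; ring.
Qed.

(** The product of the two kernels has four terms, which are the foldings of [f y] and of [f (- y)];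
    over a full period [pg_conv] evaluates each. *)
Lemma nk_conv s t x y : (0 < s)%R -> (0 < t)%R ->
  \int[mu]_(z in `[0%R, 1%R]) (nk s x z * nk t z y)%:E = (nk (s + t) x y)%:E.
Proof.
move=> s0 t0; pose f y z := (pg s (x - z) * pg t (z - y))%R.
have f0 c z : (0 <= f c z)%R by rewrite mulr_ge0// pg_ge0.
have mf c : measurable_fun setT (f c).
  by apply: measurable_funM; apply: measurable_pg_comp; exact: measurable_funB.
transitivity (\int[mu]_(z in `[0%R, 1%R])
    ((f y z + f y (- z)%R)%:E + (f (- y) z + f (- y) (- z))%R%:E)).
  apply: eq_integral => z _; rewrite -EFinD /nk /f !opprK.
  by rewrite -(pgN t (- z - y)) -(pgN t (- z + y)) !opprD !opprK; congr EFin; ring.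
have mfN c : measurable_fun setT (fun z => f c (- z)%R).
  by apply: (measurableT_comp (mf c)); exact: oppr_measurable.
rewrite ge0_integralD//; last 4 first.
- by move=> z _; rewrite lee_fin addr_ge0.
- by apply/measurable_EFinP; apply: measurable_funS (measurable_funD (mf _) (mfN _)).
- by move=> z _; rewrite lee_fin addr_ge0.
- by apply/measurable_EFinP; apply: measurable_funS (measurable_funD (mf _) (mfN _)).
by rewrite !integral_fold// !pg_conv// opprK.
Qed.

(** The distribution function at [r] of the flow started from a unit mass at [y]. *)
Definition nk_tail t r y : \bar R := \int[mu]_(x in `[r, 1%R]) (nk t x y)%:E.

Lemma nk_tail_ge0 t r y : 0 <= nk_tail t r y.
Proof. by apply: integral_ge0 => x _; rewrite lee_fin nk_ge0. Qed.

Lemma nk_tail_le1 t r y : (0 < t)%R -> (0 <= r)%R -> nk_tail t r y <= 1.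
Proof.
move=> t0 r0; rewrite -[leRHS](integral_nk_mass y t0).
apply: ge0_subset_integral => //.
- apply/measurable_EFinP; exact: measurable_funS (measurable_nkl t y).
- by move=> x _; rewrite lee_fin nk_ge0.
- by move=> x /=; rewrite !in_itv/=; lra.
Qed.

Lemma nk_tail_fin t r y : (0 < t)%R -> (0 <= r)%R -> nk_tail t r y = (fine (nk_tail t r y))%:E.
Proof.
move=> t0 r0; rewrite fineK// ge0_fin_numE ?nk_tail_ge0//.
by rewrite (le_lt_trans (nk_tail_le1 y t0 r0))// ltry.
Qed.

Lemma integral_pg_fin t a b : (0 < t)%R -> \int[mu]_(x in `[a, b]) (pg t x)%:E \is a fin_num.
Proof.
move=> t0; rewrite ge0_fin_numE; last first.
  by apply: integral_ge0 => x _; rewrite lee_fin pg_ge0.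
have [C C0 HC] := pg_bound (`|a| + `|b|) t0.
apply: (@le_lt_trans _ _ (\int[mu]_(x in `[a, b]) (cst C%:E x))).
  apply: ge0_le_integral => //.
  - by move=> x _; rewrite lee_fin pg_ge0.
  - by apply/measurable_EFinP; exact: measurable_funS (measurable_pg t).
  - move=> x /=; rewrite in_itv/= lee_fin => /andP[ax xb]; apply: HC.
    have := ler_norm b; have := ler_norm (- a)%R; rewrite normrN.
    have := normr_ge0 a; have := normr_ge0 b; lra.
rewrite integral_cst//= lebesgue_measure_itv/=.
by case: ifPn => _; rewrite ?mule0 ?ltry// -EFinD -EFinM ltry.
Qed.

(** Integrated form of d/dy [nk_tail] = p(r - y) - p(r + y), written without subtraction since the
    values are extended reals. The mass missing from the tail is the integral of [pg t] over a
    window of length 2r, and sliding this window by [y] trades one end piece for another. *)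
Lemma nk_tail_eq t r y : (0 < t)%R -> (0 <= r <= 1)%R -> (0 <= y)%R ->
  nk_tail t r y + \int[mu]_(z in `[0%R, y]) (pg t (r + z))%:E =
  nk_tail t r 0%R + \int[mu]_(z in `[0%R, y]) (pg t (r - z))%:E.
Proof.
move=> t0 /andP[r0 r1] y0.
pose J a b := \int[mu]_(x in `[a, b]) (pg t x)%:E.
have mE : measurable_fun setT (EFin \o pg t) by apply/measurable_EFinP; exact: measurable_pg.
have E0 z : 0 <= (EFin \o pg t) z by rewrite lee_fin pg_ge0.
have JS a b c : (a <= b <= c)%R -> J a c = J a b + J b c.
  by move=> abc; apply: (@ge0_integral_itv_split _ _ b _ (EFin \o pg t)) => //; exact: measurable_funS mE.
have JT c a b : \int[mu]_(x in `[a, b]) (pg t (x + c))%:E = J (a + c)%R (b + c)%R.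
  exact: (ge0_integral_itv_translate c a b mE E0).
have JO a b : J a b = J (- b)%R (- a)%R.
  rewrite /J -(ge0_integral_itv_opp _ _ mE E0); apply: eq_integral => x _.
  by rewrite /= pgN.
have A : \int[mu]_(z in `[0%R, y]) (pg t (r + z))%:E = J r (y + r)%R.
  transitivity (J (0 + r)%R (y + r)%R); last by rewrite add0r.
  rewrite -JT; apply: eq_integral => z _.
  by rewrite addrC.
have B : \int[mu]_(z in `[0%R, y]) (pg t (r - z))%:E = J (r - y)%R r.
  transitivity (J (0 + - r)%R (y + - r)%R); last by rewrite add0r [RHS]JO opprB.
  by rewrite -JT; apply: eq_integral => z _; rewrite -pgN opprB.
(* Folding the complementary piece [0,r] produces the window [-r-w, r-w]. *)
have tail w : (0 <= w)%R -> nk_tail t r w + J (- r - w)%R (r - w)%R = 1.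
  move=> w0; have mn : measurable_fun setT (fun x => (nk t x w)%:E).
    by apply/measurable_EFinP; exact: measurable_nkl.
  have r01 : (0 <= r <= 1)%R by rewrite r0.
  have S := @ge0_integral_itv_split R 0%R r 1%R _ r01 (measurable_funTS mn)
    (fun x _ => nk_ge0 t x w).
  have mp : measurable_fun setT (fun z => pg t (z + - w)).
    by apply: measurable_pg_comp; exact: measurable_funD.
  have F := integral_fold r0 mp (fun z => pg_ge0 t (z + - w)).
  transitivity (\int[mu]_(x in `[0%R, 1%R]) (nk t x w)%:E); last exact: integral_nk_mass.
  rewrite S addeC; congr (_ + _); rewrite -JT -F.
  apply: eq_integral => z _.
  by rewrite /nk -(pgN t (z + w)) opprD.
have := tail _ y0; have := tail _ (lexx 0%R); rewrite !subr0 A B.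
(* The interval [-r-y, r] is split in two ways, at r-y and at -r. *)
have := JS (- r - y)%R (r - y)%R r; have := JS (- r - y)%R (- r)%R r.
rewrite (JO (- r - y)%R (- r)%R) opprK opprB opprK.
have fJ a b : {j | J a b = j%:E}.
  by exists (fine (J a b)); exact: (esym (fineK (integral_pg_fin a b t0))).
have [j1 ->] := fJ r (y + r)%R; have [j2 ->] := fJ (r - y)%R r.
have [j3 ->] := fJ (- r - y)%R (r - y)%R; have [j4 ->] := fJ (- r)%R r.
have [j5 ->] := fJ (- r - y)%R r.
have fp w : {p | nk_tail t r w = p%:E} by exists (fine (nk_tail t r w)); exact: nk_tail_fin.
have [p0 ->] := fp 0%R; have [p1 ->] := fp y.
rewrite -!EFinD.
move=> H1 H2 H3 H4; congr EFin.
have H5 : j5%:E = (j1 + j4)%:E by apply: H1; lra.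
have H6 : j5%:E = (j3 + j2)%:E by apply: H2; lra.
move: (EFin_inj H3) (EFin_inj H4) (EFin_inj H5) (EFin_inj H6); lra.
Qed.

End NeumannKernel.

(** * Monotonicity of the periodized Gaussian for small times *)

Section SmallTime.
Variable R : realType.
Implicit Types (t x y z : R).

Lemma le0_is_derive_le (f f' : R -> R) a b x y :
  (forall x, is_derive x 1 f (f' x)) -> (forall x, a < x < b -> f' x <= 0) ->
  a <= x -> x <= y -> y <= b -> f y <= f x.
Proof.
move=> df f'0 ax xy yb; apply: (@ler0_derive1_le_cc _ f a b) => //.
- by move=> z; rewrite in_itv/= derive1E => /f'0; have [_ ->] := df z.
- apply: continuous_subspaceT => z.
  by apply/differentiable_continuous/derivable1_diffP; have [] := df z.
- by rewrite in_itv/=; lra.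
- by rewrite in_itv/=; lra.
Qed.

Lemma is_derive_gauss t c e y : 0 < t ->
  is_derive y 1 (fun y => gauss t (c + e * y))
    (- (e * (c + e * y) / t) * gauss t (c + e * y)).
Proof.
move=> t0; rewrite /gauss; apply: is_derive_eq; rewrite /GRing.scale/=.
set S := (Num.sqrt _)^-1; set E := expR _.
by field; rewrite gt_eqF.
Qed.

Lemma gauss_rel t a b : 0 < t ->
  gauss t a = gauss t b * expR ((b ^+ 2 - a ^+ 2) / (2 * t)).
Proof.
move=> t0; rewrite /gauss [RHS]mulrAC -expRD; congr (expR _ / _).
by field; rewrite gt_eqF.
Qed.

(** Up to the factor [gauss t (m + y) / t], the derivative in y is (m - y) exp(2my/t) - (m + y).
    Since exp(a) >= 1 + a, it is nonnegative once m(m - y) >= t, which holds for m >= 1, y <= 1/2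
    and t <= 1/2. *)
Lemma gauss_pair_le t m y y' : 0 < t -> t <= 1 / 2 -> 1 <= m ->
  0 <= y -> y <= y' -> y' <= 1 / 2 ->
  gauss t (m - y) + gauss t (m + y) <= gauss t (m - y') + gauss t (m + y').
Proof.
move=> t0 t2 m1 y0 yy' y2; rewrite -lerN2.
pose f y := - (gauss t (m + -1 * y) + gauss t (m + 1 * y)).
have fE z : - (gauss t (m - z) + gauss t (m + z)) = f z by rewrite /f mulN1r mul1r.
rewrite !fE.
have df z : is_derive z 1 f (- (- (-1 * (m + -1 * z) / t) * gauss t (m + -1 * z)
    + - (1 * (m + 1 * z) / t) * gauss t (m + 1 * z))).
  have := is_derive_gauss m (-1) z t0; have := is_derive_gauss m 1 z t0.
  by move=> ? ?; exact: is_deriveN.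
apply: (le0_is_derive_le df (a := 0) (b := 1 / 2)) => // {y y' y0 yy' y2} z /andP[z0 z2].
rewrite (gauss_rel _ (m + 1 * z) t0).
have -> : ((m + 1 * z) ^+ 2 - (m + -1 * z) ^+ 2) / (2 * t) = 2 * m * z / t.
  by field; rewrite gt_eqF.
set g := gauss _ _; have g0 : 0 <= g by exact: gauss_ge0.
have e1 := expR_ge1Dx (2 * m * z / t); set E := expR _ in e1 *.
have -> : - (- (-1 * (m + -1 * z) / t) * (g * E) + - (1 * (m + 1 * z) / t) * g) =
   - (g / t * ((m - z) * E - (m + z))) by field; rewrite gt_eqF.
rewrite oppr_le0 mulr_ge0//; first by rewrite divr_ge0// ltW.
rewrite subr_ge0; apply: (@le_trans _ _ ((m - z) * (1 + 2 * m * z / t))); last first.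
  by rewrite ler_wpM2l//; lra.
have -> : (m - z) * (1 + 2 * m * z / t) = m - z + 2 * z * (m * (m - z) / t).
  by field; rewrite gt_eqF.
have : 1 <= m * (m - z) / t by rewrite ler_pdivlMr// mul1r; nra.
nra.
Qed.

(* The weights [2^-k] sum to 1, so that the image at distance [2k] only competes
   with its own share of the central Gaussian. *)
Lemma gauss_share_le t (k : nat) y y' : 0 < t -> t <= 1 / 128 -> (0 < k)%N ->
  0 <= y -> y <= y' -> y' <= 1 / 2 ->
  gauss t y' / (2 ^ k)%:R + (gauss t (2 * k%:R - y') + gauss t (2 * k%:R + y')) <=
  gauss t y / (2 ^ k)%:R + (gauss t (2 * k%:R - y) + gauss t (2 * k%:R + y)).
Proof.
move=> t0 t2 k0 y0 yy' y2; set c := (2 ^ k)%:R^-1; set m := 2 * k%:R.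
pose f y := c * gauss t (0 + 1 * y) + (gauss t (m + -1 * y) + gauss t (m + 1 * y)).
have fE z : gauss t z * c + (gauss t (m - z) + gauss t (m + z)) = f z.
  by rewrite /f mulN1r !mul1r add0r mulrC.
rewrite !fE.
have df z : is_derive z 1 f (c * (- (1 * (0 + 1 * z) / t) * gauss t (0 + 1 * z)) +
    (- (-1 * (m + -1 * z) / t) * gauss t (m + -1 * z)
    + - (1 * (m + 1 * z) / t) * gauss t (m + 1 * z))).
  have := is_derive_gauss m (-1) z t0; have := is_derive_gauss m 1 z t0.
  have := is_derive_gauss 0 1 z t0.
  move=> ? ? ?; apply: is_deriveD; exact: is_deriveZ.
apply: (le0_is_derive_le df (a := 0) (b := 1 / 2)) => // {y y' y0 yy' y2} z /andP[z0 z2].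
have k1 : 1 <= k%:R :> R by rewrite ler1n.
(* The quotients of the two images by the central Gaussian are exp(X)/Q and exp(-X)/Q. *)
pose X := m * z / t; pose Q := expR (2 * k%:R ^+ 2 / t).
have Q0 : 0 < Q by exact: expR_gt0.
rewrite (gauss_rel (m + -1 * z) (0 + 1 * z) t0) (gauss_rel (m + 1 * z) (0 + 1 * z) t0).
have -> : expR (((0 + 1 * z) ^+ 2 - (m + -1 * z) ^+ 2) / (2 * t)) = expR X / Q.
  rewrite /Q -expRN -expRD /X /m; congr expR; field; rewrite gt_eqF//.
have -> : expR (((0 + 1 * z) ^+ 2 - (m + 1 * z) ^+ 2) / (2 * t)) = expR (- X) / Q.
  rewrite /Q -expRN -expRD /X /m; congr expR; field; rewrite gt_eqF//.
set g := gauss _ _; have g0 : 0 <= g by exact: gauss_ge0.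
set E := expR X; set E' := expR (- X).
have -> : c * (- (1 * (0 + 1 * z) / t) * g) +
    (- (-1 * (m + -1 * z) / t) * (g * (E / Q)) + - (1 * (m + 1 * z) / t) * (g * (E' / Q)))
  = - (g / t / Q * (c * z * Q - ((m - z) * E - (m + z) * E'))).
  by field; rewrite !gt_eqF.
rewrite oppr_le0 mulr_ge0//; first by rewrite !divr_ge0// ltW.
rewrite subr_ge0.
have X0 : 0 <= X by rewrite /X /m !mulr_ge0// ?invr_ge0 ltW.
have E0 : 0 < E by exact: expR_gt0.
have E'0 : 0 < E' by exact: expR_gt0.
have EE' : E * E' = 1 by rewrite -expRD subrr expR0.
(* Multiply exp(-2X) >= 1 - 2X by [E], using E' = E exp(-2X). *)
have HE : E - E' <= 2 * X * E.
  have := expR_ge1Dx (- (2 * X)); have -> : - (2 * X) = - X + - X by ring.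
  rewrite expRD -/E' => h.
  have -> : E' = E * (E' * E') by rewrite mulrA EE' mul1r.
  nra.
apply: (@le_trans _ _ (m * (E - E'))); first by nra.
apply: (@le_trans _ _ (m * (2 * X * E))).
  by rewrite ler_wpM2l// /m; lra.
(* In terms of [Y], Q = exp(2Y) and E <= exp(Y), so it remains to show 8Y <= c exp(Y). The weight
   satisfies c >= exp(-Y/2) because 2^k <= exp(k) and k <= Y/2. *)
pose Y := k%:R ^+ 2 / t.
have kY : k%:R / t <= Y by rewrite /Y ler_pM2r ?invr_gt0//; nra.
have Y128 : 128 * k%:R <= Y.
  apply: le_trans kY; rewrite ler_pdivlMr//; nra.
have EY : E <= expR Y.
  rewrite ler_expR; apply: le_trans kY; rewrite /X ler_pM2r ?invr_gt0// /m; nra.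
have QE : Q = expR Y * expR Y by rewrite -expRD /Q; congr expR; rewrite /Y; field; rewrite gt_eqF.
have c2 : expR (- (Y / 2)) <= c.
  rewrite expRN /c lef_pV2 ?posrE ?expR_gt0 ?ltr0n ?expn_gt0//.
  rewrite natrX; apply: (@le_trans _ _ (expR k%:R)).
    rewrite -[k%:R]mulr1 expRM_natl lerXn2r ?nnegrE ?expR_ge0//.
    by have := expR_ge1Dx (1 : R); lra.
  by rewrite ler_expR; lra.
(* Squaring exp(Y/4) >= 1 + Y/4 gives this for Y >= 128, which is where the bound 1/128 on [t] comes
   from. *)
have H8 : 8 * Y <= expR (Y / 2).
  have h := expR_ge1Dx (Y / 4).
  have -> : expR (Y / 2) = expR (Y / 4) * expR (Y / 4) by rewrite -expRD; congr expR; field.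
  nra.
have -> : m * (2 * X * E) = z * (8 * Y * E) by rewrite /X /Y /m; field; rewrite gt_eqF.
rewrite -[leRHS]mulrA [leRHS]mulrCA ler_wpM2l//; first exact: ltW.
rewrite QE (mulrA c); apply: ler_pM => //.
- by lra.
- exact: ltW.
apply: (le_trans H8).
have -> : expR (Y / 2) = expR (- (Y / 2)) * expR Y by rewrite -expRD; congr expR; field.
by rewrite ler_wpM2r// expR_ge0.
Qed.

End SmallTime.

Section PgMonotone.
Variable R : realType.
Local Open Scope ereal_scope.
Implicit Types (r t x y z : R).

Let gE t z : 0 <= (gauss t z)%:E.
Proof. by rewrite lee_fin gauss_ge0. Qed.

(** Seen from 1, the images form pairs symmetric about the odd points 2n + 1, the configuration of
    [gauss_pair_le]. *)
Lemma pgauss_odd t y : pgauss t (1 - y) =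
  \sum_(n <oo) (gauss t ((2 * n%:R + 1) - y) + gauss t ((2 * n%:R + 1) + y))%:E.
Proof.
have E (a b : R) : (a = - b)%R -> (gauss t a)%:E = (gauss t b)%:E by move=> ->; rewrite gaussN.
rewrite pgaussE; transitivity (\sum_(n <oo) (gauss t ((2 * n%:R + 1) - y))%:E +
   \sum_(n <oo) (gauss t ((2 * n%:R + 1) + y))%:E); last first.
  by rewrite -nneseriesD//; apply: eq_eseriesr => n _; rewrite EFinD.
rewrite nneseries_gauss_recl [in RHS]nneseries_gauss_recl -addeA -[RHS]addeA.
rewrite [X in _ + X]addeC; congr (_ + (_ + _)).
- by congr (gauss t _)%:E; ring.
- by apply: eq_eseriesr => n _; congr (gauss t _)%:E; rewrite -!natr1; ring.
- by apply: eq_eseriesr => n _; apply: E; rewrite -!natr1; ring.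
Qed.

Lemma nneseries_half_share (a : R) : \sum_(n <oo) (a / (2 ^ n.+1)%:R)%:E = a%:E.
Proof.
have := @cvg_geometric_eseries_half _ a 0; rewrite expr0 divr1 => h.
rewrite -[RHS](cvg_lim _ h)//; apply: congr_lim; apply/funext => n.
by apply: eq_bigr => i _; rewrite addn1.
Qed.

(** Distributes the central Gaussian over the pairs of images with weights 2^-(n+1), so that
    [gauss_share_le] applies term by term. *)
Lemma pgauss_share t z : pgauss t z =
  \sum_(n <oo) (gauss t z / (2 ^ n.+1)%:R +
     (gauss t (2 * n.+1%:R - z) + gauss t (2 * n.+1%:R + z)))%:E.
Proof.
rewrite pgaussE nneseries_gauss_recl mulr0 subr0 -{1}(nneseries_half_share (gauss t z)).
rewrite -addeA -!nneseriesD//; last first.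
  by move=> n _ _; rewrite adde_ge0.
  by move=> n _ _; rewrite lee_fin divr_ge0// gauss_ge0.
apply: eq_eseriesr => n _; rewrite -!EFinD -(gaussN t (z - _)).
by congr (_ + (gauss t _ + gauss t _))%:E; ring.
Qed.

Lemma pg_le_near0 t z z' : (0 < t)%R -> (t <= 1 / 128)%R -> (0 <= z)%R -> (z <= z')%R ->
  (z' <= 1 / 2)%R -> (pg t z' <= pg t z)%R.
Proof.
move=> t0 t2 z0 zz' z'2; rewrite -lee_fin -!pgauss_fin// !pgauss_share.
apply: lee_nneseries => n _; rewrite lee_fin.
  by rewrite !addr_ge0 ?gauss_ge0// divr_ge0// gauss_ge0.
exact: gauss_share_le.
Qed.

Lemma pg_le_near1 t y y' : (0 < t)%R -> (t <= 1 / 128)%R -> (0 <= y)%R -> (y <= y')%R ->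
  (y' <= 1 / 2)%R -> (pg t (1 - y) <= pg t (1 - y'))%R.
Proof.
move=> t0 t2 y0 yy' y'2; rewrite -lee_fin -!pgauss_fin// !pgauss_odd.
apply: lee_nneseries => n _; rewrite lee_fin.
  by rewrite !addr_ge0 ?gauss_ge0.
apply: gauss_pair_le => //; first lra.
by rewrite lerDr mulr_ge0.
Qed.

Lemma pg_le t z z' : (0 < t)%R -> (t <= 1 / 128)%R -> (0 <= z)%R -> (z <= z')%R ->
  (z' <= 1)%R -> (pg t z' <= pg t z)%R.
Proof.
move=> t0 t2 z0 zz' z'1.
have h a b : (1 / 2 <= a)%R -> (a <= b)%R -> (b <= 1)%R -> (pg t b <= pg t a)%R.
  move=> a2 ab b1; rewrite -(subKr 1%R a) -(subKr 1%R b).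
  by apply: pg_le_near1 => //; lra.
have [z'2|z'2] := leP z' (1 / 2)%R; first exact: pg_le_near0.
have [z2|z2] := leP (1 / 2)%R z; first exact: h.
apply: (@le_trans _ _ (pg t (1 / 2))); first by apply: h => //; lra.
by apply: pg_le_near0 => //; lra.
Qed.

(** By parity and periodicity both arguments can be brought into [0,1], where [pg_le] applies: |r -
    z| is at most r + z and at most 2 - (r + z). *)
Lemma pg_sum_le_diff t r z : (0 < t)%R -> (t <= 1 / 128)%R -> (0 <= r <= 1)%R ->
  (0 <= z <= 1)%R -> (pg t (r + z) <= pg t (r - z))%R.
Proof.
move=> t0 t2 r01 z01.
have -> : pg t (r - z) = pg t `|r - z|%R.
  by have [h|h] := leP 0%R (r - z)%R; [rewrite ger0_norm|rewrite ltr0_norm// pgN].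
have a0 : (0 <= `|r - z|)%R by exact: normr_ge0.
have [h|h] := leP (r + z)%R 1%R.
  by apply: pg_le => //; rewrite ler_norml; lra.
have -> : pg t (r + z) = pg t (2 - (r + z)).
  by rewrite -(pgN t (2 - _)) -(pg_periodic t (- _)); congr pg; ring.
by apply: pg_le => //; rewrite ?ler_norml; lra.
Qed.

End PgMonotone.

(** * Measures with integrable density *)

Section Measures.
Variable R : realType.
Local Notation mu := (@lebesgue_measure R).
Implicit Types (a r s t x y z : R) (u v w : mes R).

(* Membership in [inU] up to weakening boundedness of the density to
   integrability, which makes stability under [Gconv] immediate from Tonelli. *)
Definition admissible u : Prop :=
  [/\ 0 <= mc u, measurable_fun (`[0%R, 1%R] : set R) (mrho u),
      forall r, 0 <= r <= 1 -> 0 <= mrho u r &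
      (\int[mu]_(x in `[0%R, 1%R]) (mrho u x)%:E < +oo)%E].

Lemma inU_admissible u : inU u -> admissible u.
Proof.
move=> [c0 [mr [r0 [M HM]]]]; split => //.
apply: (@le_lt_trans _ _ (\int[mu]_(x in `[0%R, 1%R]) (cst M%:E x))%E).
  apply: ge0_le_integral => //.
  - exact/measurable_EFinP.
  - by move=> x /=; rewrite in_itv/= lee_fin => x01; apply: le_trans (HM _ x01); exact: ler_norm.
by rewrite integral_cst//= lebesgue_measure_itv/= lte_fin ltr01 sube0 mule1 ltry.
Qed.

Section AdmissibleTheory.
Variable u : mes R.
Hypothesis Mu : admissible u.

Lemma measurable_mrho_itv a b : 0 <= a -> b <= 1 -> measurable_fun `[a, b] (mrho u).
Proof.
move=> a0 b1; have [_ + _ _] := Mu; apply: measurable_funS => // x /=.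
rewrite !in_itv/=; lra.
Qed.

Lemma mrho_ge0 x : 0 <= x <= 1 -> 0 <= mrho u x.
Proof. by have [_ _ + _] := Mu; exact. Qed.

Lemma integral_mrho_fin a b : 0 <= a -> b <= 1 ->
  (\int[mu]_(x in `[a, b]) (mrho u x)%:E \is a fin_num)%E.
Proof.
move=> a0 b1; rewrite ge0_fin_numE; last first.
  by apply: integral_ge0 => x /=; rewrite in_itv/= => x1; rewrite lee_fin mrho_ge0//; lra.
have [_ mr r0] := Mu; apply: le_lt_trans; apply: ge0_subset_integral => //.
  exact/measurable_EFinP.
by move=> x /=; rewrite !in_itv/=; lra.
Qed.

(** Finiteness matters here: the real integral in [Fd] would default to 0 on an infinite value. *)
Lemma FdE r : 0 <= r -> (Fd r (mrho u))%:E = (\int[mu]_(x in `[r, 1%R]) (mrho u x)%:E)%E.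
Proof. by move=> r0; rewrite /Fd /Rintegral fineK// integral_mrho_fin. Qed.

Lemma Fd_ge0 r : 0 <= r -> 0 <= Fd r (mrho u).
Proof.
move=> r0; rewrite -lee_fin FdE//; apply: integral_ge0 => x /=.
by rewrite in_itv/= => x1; rewrite lee_fin mrho_ge0//; lra.
Qed.

Lemma Fd_split a b : 0 <= a -> a <= b -> b <= 1 ->
  (Fd a (mrho u))%:E = (\int[mu]_(x in `[a, b]) (mrho u x)%:E + (Fd b (mrho u))%:E)%E.
Proof.
move=> a0 ab b1; rewrite !FdE//; last exact: le_trans ab.
rewrite (@ge0_integral_itv_split _ a b 1)//.
- by rewrite ab.
- by apply/measurable_EFinP; exact: measurable_mrho_itv.
- by move=> x /=; rewrite in_itv/= => x1; rewrite lee_fin mrho_ge0//; lra.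
Qed.

Lemma Fd_le a b : 0 <= a -> a <= b -> b <= 1 -> Fd b (mrho u) <= Fd a (mrho u).
Proof.
move=> a0 ab b1; rewrite -lee_fin (Fd_split a0 ab b1) leeDr//.
apply: integral_ge0 => x /=.
by rewrite in_itv/= => x1; rewrite lee_fin mrho_ge0//; lra.
Qed.

Lemma Fd1 : Fd 1 (mrho u) = 0.
Proof. by rewrite /Fd set_itv1 Rintegral_set1. Qed.

(** Intermediate value theorem for the indefinite integral of the density, which is continuous by
    integrability. *)
Lemma Fd_surjective a : 0 <= a <= Fd 0 (mrho u) ->
  exists2 r, 0 <= r <= 1 & Fd r (mrho u) = a.
Proof.
move=> /andP[a0 aF]; have [_ mr r0 fin] := Mu.
have iu : mu.-integrable `[0%R, 1%R] (EFin \o mrho u).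
  apply/integrableP; split; first exact/measurable_EFinP.
  apply: le_lt_trans fin; rewrite le_eqVlt; apply/orP; left; apply/eqP.
  apply: eq_integral => x.
  by rewrite inE/= in_itv/= => x1; rewrite /= ger0_norm// r0.
have C := parameterized_integral_continuous ler01 iu.
pose P x := parameterized_integral mu 0 x (mrho u).
have PE x : 0 <= x <= 1 -> P x = Fd 0 (mrho u) - Fd x (mrho u).
  move=> /andP[x0 x1]; have := Fd_split (lexx 0) x0 x1.
  rewrite -[X in (X + _)%E]fineK ?integral_mrho_fin// -EFinD => -[->].
  by rewrite addrK.
have P0 : P 0 = 0 by rewrite PE ?lexx ?ler01// subrr.
have P1 : P 1 = Fd 0 (mrho u) by rewrite PE ?lexx ?ler01// Fd1 subr0.
have [] := @IVT _ P 0 1 (Fd 0 (mrho u) - a) ler01 C.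
  by rewrite P0 P1 min_l ?max_r ?Fd_ge0//; lra.
move=> r; rewrite in_itv/= => r01; rewrite PE// => h.
by exists r => //; lra.
Qed.

End AdmissibleTheory.

End Measures.

(** * The cut *)

Section Cut.
Variable R : realType.
Local Notation mu := (@lebesgue_measure R).
Implicit Types (j d r s t x y z : R) (u v w : mes R).

Lemma F0E u : F 0 u = mc u + Fd 0 (mrho u).
Proof. by rewrite /F eqxx. Qed.

Lemma FFd r u : r != 0 -> F r u = Fd r (mrho u).
Proof. by move=> /negbTE r0; rewrite /F r0 add0r. Qed.

Section CutTheory.
Variables (j d : R) (u : mes R).
Hypotheses (Mu : admissible u) (a0 : 0 < j * d) (aF : j * d < Fd 0 (mrho u)).

(** The level set is nonempty by [Fd_surjective]; monotonicity and intermediate values then show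
    that its infimum attains the level. *)
Lemma Rd_spec : 0 <= Rd j d u <= 1 /\ Fd (Rd j d u) (mrho u) = j * d.
Proof.
pose S := [set r | 0 <= r <= 1 /\ F r u = j * d].
(* At 0 both [F] and [Fd] exceed the level, so the atom does not affect the level set. *)
have SE r : S r <-> 0 <= r <= 1 /\ Fd r (mrho u) = j * d.
  have [->|r0] := eqVneq r 0; last by rewrite /S/= FFd.
  rewrite /S/= F0E; have [c0 _ _ _] := Mu.
  by split => -[r01 h]; move: aF c0; rewrite -h; lra.
have [r0 r01 Fr0] : exists2 r, 0 <= r <= 1 & Fd r (mrho u) = j * d.
  by apply: Fd_surjective => //; rewrite !ltW.
have Sr0 : S r0 by apply/SE.
have lbS : lbound S 0 by move=> x /SE[/andP[]].
have iS : has_inf S by split; [exists r0|exists 0].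
have R0 : 0 <= Rd j d u by apply: lb_le_inf => //; exists r0.
have Rr0 : Rd j d u <= r0 by apply: ge_inf => //; exists 0.
have R01 : 0 <= Rd j d u <= 1 by rewrite R0 (le_trans Rr0)//; case/andP: r01.
split=> //; apply/eqP; rewrite eq_le; apply/andP; split; last first.
  by rewrite -Fr0; apply: Fd_le => //; case/andP: r01.
(* A value strictly between would be attained to the left of every point of the
   level set, hence to the left of its infimum. *)
rewrite leNgt; apply/negP => h.
pose m := (j * d + Fd (Rd j d u) (mrho u)) / 2.
have [c c01 Fc] : exists2 r, 0 <= r <= 1 & Fd r (mrho u) = m.
  apply: Fd_surjective => //; have /andP[_ R1] := R01.
  by have := Fd_le Mu (lexx 0) R0 R1; rewrite /m; have := a0; lra.
have cR : c <= Rd j d u.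
  apply: lb_le_inf; first by exists r0.
  move=> s /SE[/andP[s0 s1] Fs]; rewrite leNgt; apply/negP => sc.
  have /andP[_ c1] := c01; have := Fd_le Mu s0 (ltW sc) c1; rewrite Fs Fc /m; lra.
have /andP[c0 _] := c01; have /andP[_ R1] := R01.
by have := Fd_le Mu c0 cR R1; rewrite Fc /m; lra.
Qed.

Lemma measurable_mrho_Kd : measurable_fun (`[0, 1] : set R) (mrho (Kd j d u)).
Proof.
have [_ mr _ _] := Mu; rewrite /Kd/=.
apply: measurable_fun_if => //.
- apply: measurable_fun_ler => //.
- apply: measurable_funS mr => //; exact: subIsetl.
Qed.

Lemma mrho_Kd_le x : 0 <= x <= 1 -> 0 <= mrho (Kd j d u) x <= mrho u x.
Proof.
by move=> /(mrho_ge0 Mu) r0; rewrite /Kd/=; case: ifP => _; rewrite lexx r0.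
Qed.

Lemma admissible_Kd : admissible (Kd j d u).
Proof.
have [c0 mr r0 fin] := Mu; split.
- by rewrite /Kd/= addr_ge0// ltW.
- exact: measurable_mrho_Kd.
- by move=> r /mrho_Kd_le/andP[].
- apply: le_lt_trans fin; apply: ge0_le_integral => //.
  + by move=> x /=; rewrite in_itv/= => /mrho_Kd_le/andP[]; rewrite lee_fin.
  + by apply/measurable_EFinP; exact: measurable_mrho_Kd.
  + exact/measurable_EFinP.
  + by move=> x /=; rewrite in_itv/= lee_fin => /mrho_Kd_le/andP[].
Qed.

Lemma integral_mrho_Kd_gt b : Rd j d u <= b -> 0 <= b -> b <= 1 ->
  (\int[mu]_(x in `[b, 1%R]) (mrho (Kd j d u) x)%:E = 0)%E.
Proof.
(* When [b] is the cut point, the density still survives at [b] itself; this null set is discarded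
   first. *)
move=> Rb b0 b1; rewrite -integral_itv_obnd_cbnd; last first.
  apply/measurable_EFinP; apply: measurable_funS measurable_mrho_Kd => // x /=.
  rewrite !in_itv/=; lra.
rewrite -[RHS](@integral0 _ _ _ mu `]b, 1%R]); apply: eq_integral => x.
rewrite inE/= in_itv/= => /andP[bx _].
by rewrite leNgt (le_lt_trans Rb).
Qed.

Lemma integral_mrho_Kd_le a b : 0 <= a -> b <= Rd j d u ->
  (\int[mu]_(x in `[a, b]) (mrho (Kd j d u) x)%:E =
   \int[mu]_(x in `[a, b]) (mrho u x)%:E)%E.
Proof.
move=> a_ge0 bR; apply: eq_integral => x; rewrite inE/= in_itv/= => /andP[_ xb].
by rewrite (le_trans xb).
Qed.

(** Left of the cut point the tail loses exactly the mass [j * d] lying beyond it; right of it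
    nothing remains, and the tail was at most [j * d]. *)
Lemma Fd_Kd r : 0 <= r <= 1 ->
  Fd r (mrho (Kd j d u)) = Num.max (Fd r (mrho u) - j * d) 0.
Proof.
move=> /andP[r0 r1]; have [/andP[R0 R1] FR] := Rd_spec.
have MK := admissible_Kd; apply: EFin_inj.
have [rR|Rr] := leP r (Rd j d u).
  rewrite max_l; last by rewrite subr_ge0 -FR; exact: Fd_le.
  rewrite (Fd_split MK r0 rR R1) (FdE MK R0) integral_mrho_Kd_gt// adde0.
  rewrite integral_mrho_Kd_le// EFinB (Fd_split Mu r0 rR R1) FR addeK//.
rewrite max_r; last by rewrite subr_le0 -FR; apply: Fd_le => //; exact: ltW.
by rewrite FdE// integral_mrho_Kd_gt// ltW.
Qed.

Lemma F_Kd r : 0 <= r <= 1 ->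
  F r (Kd j d u) = if r == 0 then F 0 u else Num.max (F r u - j * d) 0.
Proof.
move=> r01; case: ifPn => [/eqP ->|r0]; last by rewrite !FFd// Fd_Kd.
rewrite !F0E Fd_Kd ?lexx ?ler01// max_l; first by rewrite /Kd/=; ring.
by rewrite subr_ge0 ltW.
Qed.

Lemma F0_Kd : F 0 (Kd j d u) = F 0 u.
Proof. by rewrite F_Kd ?eqxx// lexx ler01. Qed.

Lemma Fd0_Kd : Fd 0 (mrho (Kd j d u)) = Fd 0 (mrho u) - j * d.
Proof. by rewrite Fd_Kd ?lexx ?ler01// max_l// subr_ge0 ltW. Qed.

End CutTheory.

Lemma mle_Kd j d u v : admissible u -> admissible v -> 0 < j * d ->
  j * d < Fd 0 (mrho u) -> j * d < Fd 0 (mrho v) ->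
  mle u v -> mle (Kd j d u) (Kd j d v).
Proof.
move=> Mu Mv a0 au av uv r r01; rewrite !F_Kd//.
case: ifPn => _; first by apply: uv; rewrite lexx ler01.
by have := uv _ r01; case: (leP (F r u - j * d)); case: (leP (F r v - j * d)); lra.
Qed.

(** Truncations x |-> max(x - a, 0) compose by adding their levels. The bound on the sum leaves
    enough density for the outer cut. *)
Lemma F_Kd_Kd j d e u r : admissible u -> 0 < j * d -> 0 < j * e ->
  j * d + j * e < Fd 0 (mrho u) -> 0 <= r <= 1 ->
  F r (Kd j d (Kd j e u)) = F r (Kd j (d + e) u).
Proof.
move=> Mu d0 e0 deF r01.
have eF : j * e < Fd 0 (mrho u) by lra.
have MK := admissible_Kd Mu e0.
have h1 : j * d < Fd 0 (mrho (Kd j e u)) by rewrite Fd0_Kd//; lra.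
have h2 : 0 < j * (d + e) by rewrite mulrDr addr_gt0.
have h3 : j * (d + e) < Fd 0 (mrho u) by rewrite mulrDr.
rewrite (F_Kd MK d0 h1 r01) (F_Kd Mu h2 h3 r01) (F_Kd Mu e0 eF r01) (F0_Kd Mu e0 eF).
case: (r == 0) => //; rewrite mulrDr.
move: d0 e0; set A := j * d; set B := j * e; set X := F r u => A0 B0.
by case: (leP (X - B) 0) => h; case: (leP (X - (A + B)) 0) => h'; case: leP; lra.
Qed.

End Cut.

(** * The heat flow *)

Section HeatFlow.
Variable R : realType.
Local Notation mu := (@lebesgue_measure R).
Local Open Scope ereal_scope.
Implicit Types (j d r s t x y z : R) (u v : mes R).

(** Extended values allow Tonelli before any finiteness is known. *)
Definition mint u (g : R -> \bar R) : \bar R :=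
  (mc u)%:E * g 0%R + \int[mu]_(y in `[0%R, 1%R]) (g y * (mrho u y)%:E).

(** Admissibility constrains the density on [0,1] only, whereas Tonelli is applied on the whole
    plane; hence the extension by zero. *)
Let rho0 u : R -> R := mrho u \_ `[0%R, 1%R].

Lemma measurable_rho0 u : admissible u -> measurable_fun setT (rho0 u).
Proof. by move=> [_ mr _ _]; apply/(measurable_restrictT (mrho u)). Qed.

Lemma rho0_ge0 u x : admissible u -> (0 <= rho0 u x)%R.
Proof.
move=> [_ _ r0 _]; rewrite /rho0 patchE; case: ifPn => // /set_mem/=.
by rewrite in_itv/=; exact: r0.
Qed.

Lemma rho0E u x : (0 <= x <= 1)%R -> rho0 u x = mrho u x.
Proof. by move=> x01; rewrite /rho0 patchE mem_set//= in_itv. Qed.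

(** The kernel is bounded and the density integrable, so the real integral in [Gconv] is finite and
    not a default value. *)
Lemma mint_fst t u x : admissible u -> (0 < t)%R -> (0 <= x <= 1)%R ->
  (mrho (Gconv t u) x)%:E = mint u (fun y => (nk t x y)%:E).
Proof.
move=> Mu t0 x01; rewrite /Gconv/= EFinD /mint -EFinM.
have x00 : (0 <= (0 : R) <= 1)%R by rewrite lexx ler01.
rewrite Gneum_nk//; congr (_ + _); rewrite /Rintegral.
rewrite (_ : \int[_]_(_ in _) _ = \int[mu]_(y in `[0%R, 1%R]) (nk t x y * mrho u y)%:E); last first.
  by apply: eq_integral => y; rewrite inE/= in_itv/= => y01; rewrite Gneum_nk.
rewrite fineK; first by apply: eq_integral => y _; rewrite EFinM.
have n0 y : (0 <= y <= 1)%R -> 0 <= (nk t x y * mrho u y)%:E.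
  by move=> y01; rewrite lee_fin mulr_ge0 ?nk_ge0// mrho_ge0.
rewrite ge0_fin_numE; last by apply: integral_ge0 => y /=; rewrite in_itv/=; exact: n0.
have [C C0 HC] := nk_bound t0; have [_ mr r0 fin] := Mu.
apply: (@le_lt_trans _ _ (\int[mu]_(y in `[0%R, 1%R]) (C%:E * (mrho u y)%:E))).
  apply: ge0_le_integral => //.
  - apply/measurable_EFinP; apply: measurable_funM => //.
    by apply: measurable_funTS; exact: measurable_nkr.
  - by apply: measurable_funeM; exact/measurable_EFinP.
  - move=> y /=; rewrite in_itv/= => y01; rewrite -EFinM lee_fin.
    by rewrite ler_wpM2r ?r0// HC.
rewrite ge0_integralZl//.
- by rewrite lte_mul_pinfty// ltry.
- exact/measurable_EFinP.
Qed.

(** Duality by Tonelli: testing the flow of [u] against [g] amounts to testing [u] against the flow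
    of [g] restricted to [D]. *)
Lemma integral_mul_Gconv t u (D : set R) (g : R -> \bar R) :
  admissible u -> (0 < t)%R -> measurable D -> D `<=` `[0%R, 1%R] ->
  measurable_fun setT g -> (forall x, 0 <= g x) ->
  \int[mu]_(x in D) (g x * (mrho (Gconv t u) x)%:E) =
  mint u (fun y => \int[mu]_(x in D) (g x * (nk t x y)%:E)).
Proof.
move=> Mu t0 mD D01 mg g0; have [c0 _ _ _] := Mu.
have gD : measurable_fun D g by exact: measurable_funTS.
pose h (w : R * R) := g w.1 * (nk t w.1 w.2 * rho0 u w.2)%:E.
have h0 w : 0 <= h w.
  by rewrite mule_ge0// lee_fin mulr_ge0 ?nk_ge0// rho0_ge0.
have mh : measurable_fun setT h.
  apply: emeasurable_funM; first exact: (measurableT_comp mg).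
  apply/measurable_EFinP; apply: measurable_funM; first exact: measurable_nk.
  exact: (measurableT_comp (measurable_rho0 Mu)).
have mgn y : measurable_fun setT (fun x => g x * (nk t x y)%:E).
  by apply: emeasurable_funM => //; apply/measurable_EFinP; exact: measurable_nkl.
have gn0 x y : 0 <= g x * (nk t x y)%:E by rewrite mule_ge0// lee_fin nk_ge0.
transitivity (\int[mu]_(x in D) ((mc u)%:E * (g x * (nk t x 0)%:E) +
    \int[mu]_(y in `[0%R, 1%R]) h (x, y))).
  apply: eq_integral => x /set_mem/D01/=; rewrite in_itv/= => x01.
  rewrite mint_fst// /mint ge0_muleDr; last 2 first.
  - by rewrite mule_ge0 ?lee_fin ?nk_ge0.
  - apply: integral_ge0 => y /=; rewrite in_itv/= => y01.
    by rewrite mule_ge0 ?lee_fin ?nk_ge0// mrho_ge0.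
  rewrite muleCA; congr (_ + _); rewrite -ge0_integralZl//.
  - by apply: eq_integral => y; rewrite inE/= in_itv/= => y01; rewrite /h/= rho0E// EFinM.
  - apply/measurable_EFinP; apply: measurable_funM; last by have [_ + _ _] := Mu.
    by apply: measurable_funTS; exact: measurable_nkr.
  - by move=> y /=; rewrite in_itv/= => y01; rewrite mule_ge0 ?lee_fin ?nk_ge0// mrho_ge0.
rewrite ge0_integralD//; last 4 first.
- by move=> x _; rewrite mule_ge0.
- by apply: measurable_funTS; apply: measurable_funeM; exact: mgn.
- by move=> x _; exact: integral_ge0.
- by apply: measurable_funTS; exact: measurable_fun_ge0_integral.
rewrite ge0_integralZl//; last by apply: measurable_funTS; exact: mgn.
congr (_ + _); rewrite ge0_integral_exchange//; apply: eq_integral => y.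
rewrite inE/= in_itv/= => y01; rewrite -ge0_integralZr//.
- by apply: eq_integral => x _; rewrite /h/= rho0E// EFinM muleA.
- by apply: measurable_funTS; exact: mgn.
- by rewrite lee_fin mrho_ge0.
Qed.

Lemma measurable_nk_swap t : measurable_fun setT (fun w : R * R => nk t w.2 w.1).
Proof.
by apply: measurable_funD; apply: measurable_pg_comp;
  [exact: measurable_funB|exact: measurable_funD].
Qed.

Lemma measurable_nk_tail t r : measurable_fun setT (nk_tail t r).
Proof.
pose h (w : R * R) := (nk t w.2 w.1)%:E.
have mh : measurable_fun setT h by apply/measurable_EFinP; exact: measurable_nk_swap.
have h0 w : 0 <= h w by rewrite lee_fin nk_ge0.
exact: (measurable_fun_ge0_integral (measurable_itv `[r, 1%R]) mh h0).
Qed.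

Lemma integral_mrho_Gconv t u r : admissible u -> (0 < t)%R -> (0 <= r)%R ->
  \int[mu]_(x in `[r, 1%R]) (mrho (Gconv t u) x)%:E = mint u (nk_tail t r).
Proof.
move=> Mu t0 r0; have r1 : (`[r, 1%R] : set R) `<=` `[0%R, 1%R].
  by move=> x /=; rewrite !in_itv/=; lra.
have E := integral_mul_Gconv Mu t0 (measurable_itv `[r, 1%R]) r1
  (@measurable_cst _ _ _ _ setT 1) (fun=> lee01).
transitivity (\int[mu]_(x in `[r, 1%R]) (1 * (mrho (Gconv t u) x)%:E)).
  by apply: eq_integral => x _; rewrite mul1e.
rewrite E; congr (mint _ _); apply/funext => y; rewrite /nk_tail.
by apply: eq_integral => x _; rewrite mul1e.
Qed.

Lemma le_mint u f g : admissible u -> measurable_fun setT f -> measurable_fun setT g ->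
  (forall y, 0 <= f y) -> (forall y, (0 <= y <= 1)%R -> f y <= g y) -> mint u f <= mint u g.
Proof.
move=> Mu mf mg f0 fg; have [c0 mr r0 _] := Mu; rewrite /mint leeD//.
  by rewrite lee_pmul// fg ?lexx ?ler01.
apply: ge0_le_integral => //.
- by move=> y /=; rewrite in_itv/= => y01; rewrite mule_ge0// lee_fin r0.
- by apply: emeasurable_funM; [exact: measurable_funTS|exact/measurable_EFinP].
- by apply: emeasurable_funM; [exact: measurable_funTS|exact/measurable_EFinP].
- by move=> y /=; rewrite in_itv/= => y01; rewrite lee_pmul// ?lee_fin ?r0// fg.
Qed.

Lemma mint1 u : admissible u -> mint u (cst 1) = (F 0 u)%:E.
Proof.
move=> Mu; rewrite /mint mule1 F0E EFinD (FdE Mu)//; congr (_ + _).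
by apply: eq_integral => y _; rewrite mul1e.
Qed.

(** Integrability follows from duality with g = 1: tails are at most 1, so the total mass is at most
    [F 0 u]. *)
Lemma admissible_Gconv t u : admissible u -> (0 < t)%R -> admissible (Gconv t u).
Proof.
move=> Mu t0; have [c0 _ _ _] := Mu.
pose h (w : R * R) := (nk t w.1 w.2 * rho0 u w.2)%:E.
have mh : measurable_fun setT h.
  apply/measurable_EFinP; apply: measurable_funM; first exact: measurable_nk.
  exact: (measurableT_comp (measurable_rho0 Mu)).
have h0 w : 0 <= h w by rewrite lee_fin mulr_ge0 ?nk_ge0// rho0_ge0.
split=> //.
- apply: (@eq_measurable_fun _ _ _ _ _ (fun x => fine ((mc u * nk t x 0)%:E +
    \int[mu]_(y in `[0%R, 1%R]) h (x, y)))).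
    move=> x /set_mem/=; rewrite in_itv/= => x01.
    rewrite -[RHS]/(fine (mrho (Gconv t u) x)%:E) mint_fst// /mint EFinM.
    congr (fine (_ + _)); apply: eq_integral => y; rewrite inE/= in_itv/= => y01.
    by rewrite /h/= rho0E// EFinM.
  apply: measurable_funTS; apply: measurableT_comp => //.
  apply: emeasurable_funD; last exact: measurable_fun_ge0_integral.
  apply/measurable_EFinP; apply: measurable_funM => //; exact: measurable_nkl.
- move=> x x01; rewrite -lee_fin mint_fst// /mint adde_ge0 ?mule_ge0 ?lee_fin ?nk_ge0//.
  apply: integral_ge0 => y /=; rewrite in_itv/= => y01.
  by rewrite mule_ge0 ?lee_fin ?nk_ge0// mrho_ge0.
- rewrite integral_mrho_Gconv//; apply: (@le_lt_trans _ _ (mint u (cst 1))).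
    apply: le_mint => //; first exact: measurable_nk_tail.
      by move=> y; exact: nk_tail_ge0.
    by move=> y _; exact: nk_tail_le1.
  by rewrite mint1// ltry.
Qed.

Lemma F_Gconv t u r : admissible u -> (0 < t)%R -> (0 <= r)%R ->
  (F r (Gconv t u))%:E = mint u (nk_tail t r).
Proof.
move=> Mu t0 r0; rewrite -integral_mrho_Gconv// -FdE//; last exact: admissible_Gconv.
by rewrite /F/= if_same add0r.
Qed.

Lemma F0_Gconv t u : admissible u -> (0 < t)%R -> F 0 (Gconv t u) = F 0 u.
Proof.
move=> Mu t0; apply: EFin_inj; rewrite F_Gconv// -mint1//; congr (mint _ _).
by apply/funext => y; exact: integral_nk_mass.
Qed.

(** Duality reduces the claim to [nk_conv] integrated over [r,1]. Equality of distribution functions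
    is all that the order sees. *)
Lemma F_Gconv_Gconv s t u r : admissible u -> (0 < s)%R -> (0 < t)%R -> (0 <= r)%R ->
  F r (Gconv s (Gconv t u)) = F r (Gconv (s + t) u).
Proof.
move=> Mu s0 t0 r0; apply: EFin_inj.
rewrite (F_Gconv (admissible_Gconv Mu t0) s0 r0) (F_Gconv Mu (addr_gt0 s0 t0) r0).
rewrite {1}/mint mul0e add0e (integral_mul_Gconv Mu t0 (measurable_itv `[0%R, 1%R])
  (@subset_refl _ _) (measurable_nk_tail s r) (nk_tail_ge0 s r)).
congr (mint _ _); apply/funext => y.
pose h (w : R * R) := (nk s w.2 w.1 * nk t w.1 y)%:E.
have mh : measurable_fun setT h.
  apply/measurable_EFinP; apply: measurable_funM.
    exact: measurable_nk_swap.
  exact: (measurableT_comp (measurable_nkl t y)).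
have h0 w : 0 <= h w by rewrite lee_fin mulr_ge0// nk_ge0.
transitivity (\int[mu]_(z in `[0%R, 1%R]) \int[mu]_(x in `[r, 1%R]) h (z, x)).
  apply: eq_integral => z _; rewrite -ge0_integralZr//.
  - by apply/measurable_EFinP; apply: measurable_funTS; exact: measurable_nkl.
  - by move=> x _; rewrite lee_fin nk_ge0.
  - by rewrite lee_fin nk_ge0.
rewrite ge0_integral_exchange//; apply: eq_integral => x _; exact: nk_conv.
Qed.

End HeatFlow.

(** * Integration by parts for the heat flow *)

Section Order.
Variable R : realType.
Local Notation mu := (@lebesgue_measure R).
Local Open Scope ereal_scope.
Implicit Types (j d r s t x y z : R) (u v : mes R).

Let adde_cancel_mid (a b c e : \bar R) : b \is a fin_num -> a + b = c + (b + e) -> a = c + e.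
Proof. by move=> bfin E; rewrite -(addeK a bfin) E [b + e]addeC addeA addeK. Qed.

(* The density of [nk_tail t r] in its second variable (the Dirichlet heat
   kernel), truncated at 0 so as to be nonnegative outside [0,1]. *)
Definition tail_density t r z : R := Num.max (pg t (r - z) - pg t (r + z))%R 0%R.

Lemma tail_density_ge0 t r z : (0 <= tail_density t r z)%R.
Proof. by rewrite le_max lexx orbT. Qed.

Lemma measurable_tail_density t r : measurable_fun setT (tail_density t r).
Proof.
apply: measurable_maxr => //; apply: measurable_funB; apply: measurable_pg_comp.
  exact: measurable_funB.
exact: measurable_funD.
Qed.

(** Cancel the finite common term in [nk_tail_eq]; on [0,1] the truncation in [tail_density] is
    inactive by [pg_sum_le_diff]. *)
Lemma nk_tail_repr t r y : (0 < t)%R -> (t <= 1 / 128)%R -> (0 <= r <= 1)%R ->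
  (0 <= y <= 1)%R ->
  nk_tail t r y = nk_tail t r 0%R + \int[mu]_(z in `[0%R, y]) (tail_density t r z)%:E.
Proof.
move=> t0 t2 r01 /andP[y0 y1].
have mp : measurable_fun setT (fun z => pg t (r + z)).
  by apply: measurable_pg_comp; exact: measurable_funD.
have := nk_tail_eq t0 r01 y0; set B := \int[mu]_(z in _) _.
have -> : \int[mu]_(z in `[0%R, y]) (pg t (r - z))%:E =
    B + \int[mu]_(z in `[0%R, y]) (tail_density t r z)%:E.
  rewrite -ge0_integralD//; last 4 first.
  - by move=> z _; rewrite lee_fin pg_ge0.
  - by apply/measurable_EFinP; apply: measurable_funTS.
  - by move=> z _; rewrite lee_fin tail_density_ge0.
  - by apply/measurable_EFinP; apply: measurable_funTS; exact: measurable_tail_density.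
  apply: eq_integral => z; rewrite inE/= in_itv/= => zy; rewrite -EFinD; congr EFin.
  rewrite /tail_density max_l ?subrKC// subr_ge0; apply: pg_sum_le_diff => //; lra.
have Bfin : B \is a fin_num.
  rewrite /B (_ : \int[mu]_(z in _) _ = \int[mu]_(z in `[r, (y + r)%R]) (pg t z)%:E).
    exact: integral_pg_fin.
  rewrite -{2}(add0r r) -(@ge0_integral_itv_translate _ r 0%R y (fun z => (pg t z)%:E)).
  - by apply: eq_integral => z _; rewrite addrC.
  - by apply/measurable_EFinP; exact: measurable_pg.
  - by move=> z; rewrite lee_fin pg_ge0.
exact: adde_cancel_mid.
Qed.

(** Integration by parts, by Tonelli on the region z <= y. The result combines the values [F 0 u]
    and [Fd z (mrho u)] with nonnegative weights, so it is monotone in the distribution function.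
    The point 0 is excluded from the integral because [F] and [Fd] may differ there. *)
Lemma mint_nk_tail t r u : admissible u -> (0 < t)%R -> (t <= 1 / 128)%R ->
  (0 <= r <= 1)%R ->
  mint u (nk_tail t r) = nk_tail t r 0%R * (F 0 u)%:E +
    \int[mu]_(z in `]0%R, 1%R]) (tail_density t r z * Fd z (mrho u))%:E.
Proof.
move=> Mu t0 t2 r01; have [c0 mr r0 _] := Mu.
pose q := tail_density t r; pose T0 := nk_tail t r 0%R.
have T00 : 0 <= T0 by exact: nk_tail_ge0.
pose rho := mrho u \_ `[0%R, 1%R] : R -> R.
have mrho0 : measurable_fun setT rho by exact: measurable_rho0.
have rhoE x : (0 <= x <= 1)%R -> rho x = mrho u x by exact: rho0E.
have rho0 x : (0 <= rho x)%R by exact: rho0_ge0.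
pose h (w : R * R) : \bar R := (if w.2 <= w.1 then q w.2 * rho w.1 else 0)%R%:E.
have h0 w : 0 <= h w.
  by rewrite lee_fin; case: ifP => // _; rewrite mulr_ge0// tail_density_ge0.
have mh : measurable_fun setT h.
  apply/measurable_EFinP; apply: measurable_fun_ifT => //; first exact: measurable_fun_ler.
  apply: measurable_funM; last exact: (measurableT_comp mrho0).
  by apply: (measurableT_comp (measurable_tail_density t r)).
have mhy y : measurable_fun setT (fun z => h (y, z)) by exact: measurableT_comp.
have mhz z : measurable_fun setT (fun y => h (y, z)) by exact: measurableT_comp.
have Q y : (0 <= y <= 1)%R -> (\int[mu]_(z in `[0%R, y]) (q z)%:E) * (mrho u y)%:E =
    \int[mu]_(z in `]0%R, 1%R]) h (y, z).
  move=> y01; rewrite integral_itv_obnd_cbnd; last exact: measurable_funTS.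
  rewrite (@ge0_integral_itv_split _ 0%R y 1%R)//; last exact: measurable_funTS.
  rewrite -[X in _ = _ + X]integral_itv_obnd_cbnd; last exact: measurable_funTS.
  rewrite [X in _ = _ + X](_ : _ = 0); last first.
    rewrite -[RHS](@integral0 _ _ _ mu `]y, 1%R]); apply: eq_integral => z.
    by rewrite inE/= in_itv/= => /andP[yz _]; rewrite /h/= leNgt yz.
  rewrite adde0 -ge0_integralZr//.
  - apply: eq_integral => z; rewrite inE/= in_itv/= => /andP[_ zy].
    by rewrite /h/= zy -EFinM rhoE.
  - by apply/measurable_EFinP; apply: measurable_funTS; exact: measurable_tail_density.
  - by move=> z _; rewrite lee_fin tail_density_ge0.
  - by rewrite lee_fin r0.
rewrite /mint -/T0.
transitivity ((mc u)%:E * T0 + \int[mu]_(y in `[0%R, 1%R])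
   (T0 * (mrho u y)%:E + \int[mu]_(z in `]0%R, 1%R]) h (y, z))).
  congr (_ + _); apply: eq_integral => y; rewrite inE/= in_itv/= => y01.
  rewrite nk_tail_repr// -Q// ge0_muleDl//.
  by apply: integral_ge0 => z _; rewrite lee_fin tail_density_ge0.
rewrite ge0_integralD//; last 4 first.
- by move=> y /=; rewrite in_itv/= => y01; rewrite mule_ge0// lee_fin r0.
- by apply: emeasurable_funM => //; exact/measurable_EFinP.
- by move=> y _; exact: integral_ge0.
- by apply: measurable_funTS; exact: measurable_fun_ge0_integral.
rewrite ge0_integralZl//; last exact/measurable_EFinP.
rewrite addeA [_ * T0]muleC -ge0_muleDr ?lee_fin//; last first.
  by apply: integral_ge0 => y /=; rewrite in_itv/= lee_fin; exact: r0.
rewrite -FdE// -EFinD -F0E; congr (_ + _).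
rewrite ge0_integral_exchange//; apply: eq_integral => z.
rewrite inE/= in_itv/= => /andP[z0 z1].
rewrite (@ge0_integral_itv_split _ 0%R z 1%R)//; last 2 first.
- by rewrite z1 ltW.
- exact: measurable_funTS.
rewrite -[X in X + _ = _]integral_itv_bndo_bndc; last exact: measurable_funTS.
rewrite [X in X + _ = _](_ : _ = 0); last first.
  rewrite -[RHS](@integral0 _ _ _ mu `[0%R, z[); apply: eq_integral => y.
  by rewrite inE/= in_itv/= => /andP[_ yz]; rewrite /h/= leNgt yz.
rewrite add0e EFinM FdE//; last exact: ltW.
rewrite -ge0_integralZl//.
- apply: eq_integral => y; rewrite inE/= in_itv/= => /andP[zy y1].
  by rewrite /h/= zy EFinM rhoE// y1 (le_trans (ltW z0)).
- by apply/measurable_EFinP; apply: measurable_mrho_itv => //; exact: ltW.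
- by move=> y /=; rewrite in_itv/= => /andP[zy y1]; rewrite lee_fin r0// y1 (le_trans (ltW z0)).
- by rewrite lee_fin tail_density_ge0.
Qed.

End Order.

(** * Order preservation by the heat flow, and its commutation with the cut *)

Section Barriers.
Variable R : realType.
Local Notation mu := (@lebesgue_measure R).
Implicit Types (j d r s t x y z : R) (u v w : mes R).

Lemma mle_refl u : mle u u.
Proof. by move=> r _. Qed.

Lemma mle_trans v u w : mle u v -> mle v w -> mle u w.
Proof. by move=> uv vw r r01; apply: le_trans (uv r r01) (vw r r01). Qed.

Lemma mle_eqF u v : (forall r, 0 <= r <= 1 -> F r u = F r v) -> mle u v.
Proof. by move=> uv r r01; rewrite uv. Qed.

Lemma Fd0_le_F0 u : admissible u -> Fd 0 (mrho u) <= F 0 u.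
Proof. by move=> [c0 _ _ _]; rewrite F0E lerDr. Qed.

Lemma Fd0_Gconv t u : admissible u -> 0 < t -> Fd 0 (mrho (Gconv t u)) = F 0 u.
Proof. by move=> Mu t0; rewrite -(F0_Gconv Mu t0) F0E /= add0r. Qed.

Lemma mle_Gconv_small t u v : 0 < t -> t <= 1 / 128 -> admissible u -> admissible v ->
  mle u v -> mle (Gconv t u) (Gconv t v).
Proof.
move=> t0 t2 Mu Mv uv r r01; have /andP[r0 _] := r01.
rewrite -lee_fin (F_Gconv Mu t0 r0) (F_Gconv Mv t0 r0).
rewrite (mint_nk_tail Mu t0 t2 r01) (mint_nk_tail Mv t0 t2 r01); apply: leeD.
  by apply: lee_wpmul2l; [exact: nk_tail_ge0|rewrite lee_fin uv// lexx ler01].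
have mF w : admissible w ->
    measurable_fun (`]0, 1] : set R) (fun z => (tail_density t r z * Fd z (mrho w))%:E).
  move=> Mw; apply/measurable_EFinP; apply: measurable_funM.
    by apply: measurable_funTS; exact: measurable_tail_density.
  (* Clamping the argument to [0,1] turns [Fd] into a monotone, hence measurable, function on the
     line. *)
  apply: (@eq_measurable_fun _ _ _ _ _ (fun z => Fd (Num.min 1 (Num.max 0 z)) (mrho w))).
    by move=> z /set_mem/=; rewrite in_itv/= => /andP[z0 z1]; rewrite max_r ?min_r// ltW.
  apply: nonincreasing_measurable => // a b ab; apply: Fd_le => //.
  - by rewrite le_min ler01 le_max lexx.
  - by apply: le_min2 => //; exact: le_max2.
  - by rewrite ge_min lexx.
apply: ge0_le_integral => //.
- move=> z /=; rewrite in_itv/= => /andP[z0 _].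
  by rewrite lee_fin mulr_ge0 ?tail_density_ge0// Fd_ge0// ltW.
- exact: mF.
- exact: mF.
- move=> z /=; rewrite in_itv/= => /andP[z0 z1].
  rewrite lee_fin ler_wpM2l ?tail_density_ge0//.
  by have := uv z; rewrite !FFd ?gt_eqF//; apply; rewrite ltW.
Qed.

Lemma mle_Gconv t u v : 0 < t -> admissible u -> admissible v ->
  mle u v -> mle (Gconv t u) (Gconv t v).
Proof.
(* Since n + 1 exceeds 128 t, the time [t] splits into n + 1 equal steps of length at most 1/128. *)
move=> t0 Mu Mv uv; pose n := Num.truncn (128 * t); pose s := t / n.+1%:R.
have s0 : 0 < s by rewrite divr_gt0.
have s2 : s <= 1 / 128.
  have /andP[_ h] := truncn_itv (ltW (mulr_gt0 (ltr0n _ 128) t0)).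
  by rewrite ler_pdivrMr//; move: h; rewrite -/n; lra.
have H (i : nat) : mle (Gconv (s * i.+1%:R) u) (Gconv (s * i.+1%:R) v).
  elim: i => [|i IH]; first by rewrite mulr1; exact: mle_Gconv_small.
  have si0 : 0 < s * i.+1%:R by rewrite mulr_gt0.
  rewrite -[i.+2%:R]nat1r mulrDr mulr1.
  apply: (@mle_trans (Gconv s (Gconv (s * i.+1%:R) u))).
    by apply: mle_eqF => r /andP[r0 _]; rewrite F_Gconv_Gconv.
  apply: (@mle_trans (Gconv s (Gconv (s * i.+1%:R) v))).
    by apply: mle_Gconv_small => //; exact: admissible_Gconv.
  by apply: mle_eqF => r /andP[r0 _]; rewrite F_Gconv_Gconv.
by have := H n; rewrite /s divfK.
Qed.

Let lee_add_mid (p q i a b c : \bar R) :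
  (p <= q -> a <= c -> 0 <= b -> p + (i + a) <= q + (i + b) + c)%E.
Proof. by move=> pq ac b0; rewrite addeA leeD// leeD// leeDl. Qed.

(** The cut moves to the origin a mass [j * d] which, left in place, would contribute at most
    [j * d] to [r,1] after the flow, tails being at most 1. At r = 0 both sides equal the total mass
    of [u]. *)
Lemma Kd_Gconv_le j d t u : admissible u -> 0 < t -> 0 < j * d ->
  j * d < Fd 0 (mrho u) -> mle (Kd j d (Gconv t u)) (Gconv t (Kd j d u)).
Proof.
move=> Mu t0 a0 aF r r01; have [/andP[R0 R1] FR] := Rd_spec Mu a0 aF.
have MG := admissible_Gconv Mu t0; have MK := admissible_Kd Mu a0.
have aG : j * d < Fd 0 (mrho (Gconv t u)).
  by rewrite Fd0_Gconv//; apply: lt_le_trans (Fd0_le_F0 Mu).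
rewrite (F_Kd MG a0 aG r01); case: ifPn => [/eqP ->|r_neq0].
  by rewrite !F0_Gconv// F0_Kd.
have /andP[r0 r1] := r01; have MGK := admissible_Gconv MK t0.
have FK0 : 0 <= F r (Gconv t (Kd j d u)) by rewrite (FFd _ r_neq0); exact: Fd_ge0.
(* Nonnegativity settles the second entry of the maximum; what remains bounds F(r; G u) by F(r; G K
   u) + j d. *)
rewrite ge_max FK0 andbT lerBlDr -lee_fin (EFinD (F r (Gconv t (Kd j d u)))).
rewrite (F_Gconv Mu t0 r0) (F_Gconv MK t0 r0).
have [c0 mr rp _] := Mu; pose T := nk_tail t r.
have Tp y : (0 <= T y)%E by exact: nk_tail_ge0.
have T1 y : (T y <= 1)%E by exact: nk_tail_le1.
have mT : measurable_fun setT T by exact: measurable_nk_tail.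
have mTr w (a b : R) : admissible w -> 0 <= a -> b <= 1 ->
    measurable_fun `[a, b] (fun y => (T y * (mrho w y)%:E)%E).
  move=> Mw ? ?; apply: emeasurable_funM; first exact: measurable_funTS.
  by apply/measurable_EFinP; exact: measurable_mrho_itv.
have Tr0 w y : admissible w -> 0 <= y <= 1 -> (0 <= T y * (mrho w y)%:E)%E.
  by move=> Mw y01; rewrite mule_ge0// lee_fin mrho_ge0.
have split w : admissible w -> (\int[mu]_(y in `[0%R, 1%R]) (T y * (mrho w y)%:E) =
    \int[mu]_(y in `[0%R, Rd j d u]) (T y * (mrho w y)%:E) +
    \int[mu]_(y in `[Rd j d u, 1%R]) (T y * (mrho w y)%:E))%E.
  move=> Mw; apply: ge0_integral_itv_split; first by rewrite R0.
  - exact: mTr.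
  - by move=> y /=; rewrite in_itv/=; exact: Tr0.
rewrite /mint -/T !split// {1}/Kd/= EFinD.
have -> : (\int[mu]_(y in `[0%R, Rd j d u]) (T y * (mrho (Kd j d u) y)%:E) =
           \int[mu]_(y in `[0%R, Rd j d u]) (T y * (mrho u y)%:E))%E.
  by apply: eq_integral => y; rewrite inE/= in_itv/= => /andP[_ yR]; rewrite /Kd/= yR.
have : (\int[mu]_(y in `[Rd j d u, 1%R]) (T y * (mrho u y)%:E) <= (j * d)%:E)%E.
  rewrite -FR FdE//; apply: ge0_le_integral => //.
  - by move=> y /=; rewrite in_itv/= => y1; apply: Tr0 => //; lra.
  - exact: mTr.
  - by apply/measurable_EFinP; exact: measurable_mrho_itv.
  - move=> y /=; rewrite in_itv/= => y1; rewrite -[leRHS]mul1e.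
    by apply: lee_wpmul2r => //; rewrite lee_fin rp//; lra.
have I2 : (0 <= \int[mu]_(y in `[Rd j d u, 1%R]) (T y * (mrho (Kd j d u) y)%:E))%E.
  by apply: integral_ge0 => y /=; rewrite in_itv/= => y1; apply: (Tr0 (Kd j d u) y MK); lra.
move=> I1; apply: lee_add_mid => //.
by apply: lee_wpmul2r => //; rewrite -EFinD lee_fin lerDr ltW.
Qed.

End Barriers.

(** * Barriers *)

Section BarrierOrder.
Variable R : realType.
Implicit Types (j d r s t x y z : R) (u v w : mes R).

Lemma SminusS j d n u : Sminus j d n.+1 u = Kd j d (Gconv d (Sminus j d n u)).
Proof. by []. Qed.

Lemma SplusS j d n u : Splus j d n.+1 u = Gconv d (Kd j d (Splus j d n u)).
Proof. by []. Qed.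

Lemma Sminus_add j d m n u : Sminus j d (m + n) u = Sminus j d m (Sminus j d n u).
Proof. exact: iterD. Qed.

Lemma Splus_add j d m n u : Splus j d (m + n) u = Splus j d m (Splus j d n u).
Proof. exact: iterD. Qed.

Section Step.
Variables (j d : R).
Hypotheses (j0 : 0 < j) (d0 : 0 < d).
Let a0 : 0 < j * d. Proof. exact: mulr_gt0. Qed.

(** Each cut follows a flow, which leaves no atom: the density then carries the whole conserved
    mass, and the cut fits. *)
Lemma Sminus_inv n u : admissible u -> j * d < F 0 u ->
  admissible (Sminus j d n u) /\ F 0 (Sminus j d n u) = F 0 u.
Proof.
move=> Mu aF; elim: n => [//|n [Mn Fn]]; rewrite SminusS.
have MG := admissible_Gconv Mn d0; split; first exact: admissible_Kd.
by rewrite F0_Kd ?Fd0_Gconv ?F0_Gconv ?Fn.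
Qed.

(** The first cut acts on [u] itself, whose atom it cannot reduce, so the hypothesis bears on the
    density. Later cuts act on atomless measures of the same total mass. *)
Lemma Splus_inv n u : admissible u -> j * d < Fd 0 (mrho u) ->
  [/\ admissible (Splus j d n u), F 0 (Splus j d n u) = F 0 u &
      j * d < Fd 0 (mrho (Splus j d n u))].
Proof.
move=> Mu aF; elim: n => [//|n [Mn Fn an]]; rewrite SplusS.
have MK := admissible_Kd Mn a0; split; first exact: admissible_Gconv.
- by rewrite F0_Gconv// F0_Kd.
- by rewrite Fd0_Gconv// F0_Kd// Fn; apply: lt_le_trans (Fd0_le_F0 Mu).
Qed.

Lemma mle_KdG u v : admissible u -> admissible v -> j * d < F 0 u -> j * d < F 0 v ->
  mle u v -> mle (Kd j d (Gconv d u)) (Kd j d (Gconv d v)).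
Proof.
move=> Mu Mv au av uv; apply: mle_Kd; rewrite ?Fd0_Gconv//.
- exact: admissible_Gconv.
- exact: admissible_Gconv.
- exact: mle_Gconv.
Qed.

Lemma mle_GKd u v : admissible u -> admissible v ->
  j * d < Fd 0 (mrho u) -> j * d < Fd 0 (mrho v) ->
  mle u v -> mle (Gconv d (Kd j d u)) (Gconv d (Kd j d v)).
Proof.
move=> Mu Mv au av uv; apply: mle_Gconv => //.
- exact: admissible_Kd.
- exact: admissible_Kd.
- exact: mle_Kd.
Qed.

Lemma mle_Sminus n u v : admissible u -> admissible v ->
  j * d < F 0 u -> j * d < F 0 v -> mle u v -> mle (Sminus j d n u) (Sminus j d n v).
Proof.
move=> Mu Mv au av uv; elim: n => [//|n IH]; rewrite !SminusS.
have [Mun Fun] := Sminus_inv n Mu au; have [Mvn Fvn] := Sminus_inv n Mv av.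
by apply: mle_KdG; rewrite ?Fun ?Fvn.
Qed.

Lemma mle_Splus n u v : admissible u -> admissible v ->
  j * d < Fd 0 (mrho u) -> j * d < Fd 0 (mrho v) ->
  mle u v -> mle (Splus j d n u) (Splus j d n v).
Proof.
move=> Mu Mv au av uv; elim: n => [//|n IH]; rewrite !SplusS.
have [Mun _ aun] := Splus_inv n Mu au; have [Mvn _ avn] := Splus_inv n Mv av.
exact: mle_GKd.
Qed.

(** By induction, K G S^- <= K G S^+ <= G K S^+. *)
Lemma Sminus_le_Splus n u : admissible u -> j * d < Fd 0 (mrho u) ->
  mle (Sminus j d n u) (Splus j d n u).
Proof.
move=> Mu au; have auF := lt_le_trans au (Fd0_le_F0 Mu).
elim: n => [|n IH]; first exact: mle_refl.
have [Mm Fm] := Sminus_inv n Mu auF; have [Mp Fp ap] := Splus_inv n Mu au.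
rewrite SminusS SplusS; apply: (@mle_trans _ (Kd j d (Gconv d (Splus j d n u)))).
  by apply: mle_KdG; rewrite ?Fm ?Fp.
exact: Kd_Gconv_le.
Qed.

(* One step of length [i d] against [i] steps of length [d]: since
   [K_b G <= G K_b], postponing the cuts (lower barriers) decreases the result
   and anticipating them (upper barriers) increases it. *)
Lemma coarse_Sminus_le i u : admissible u -> j * (d *+ i.+1) < F 0 u ->
  mle (Kd j (d *+ i.+1) (Gconv (d *+ i.+1) u)) (Sminus j d i.+1 u).
Proof.
move=> Mu; elim: i => [|i IH] aF; first by rewrite mulr1n; exact: mle_refl.
have e0 : 0 < d *+ i.+1 by rewrite mulrn_wgt0.
have b0 : 0 < j * (d *+ i.+1) by exact: mulr_gt0.
have abF : j * d + j * (d *+ i.+1) < F 0 u by rewrite -mulrDr -mulrS.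
have aF1 : j * d < F 0 u by lra.
have bF1 : j * (d *+ i.+1) < F 0 u by have := a0; lra.
have {}IH := IH bF1.
set e := d *+ i.+1 in e0 b0 abF bF1 IH *.
have MG := admissible_Gconv Mu e0; have MGG := admissible_Gconv MG d0.
have [MS FS] := Sminus_inv i.+1 Mu aF1.
have FdG : Fd 0 (mrho (Gconv e u)) = F 0 u by rewrite Fd0_Gconv.
have FdGG : Fd 0 (mrho (Gconv d (Gconv e u))) = F 0 u by rewrite Fd0_Gconv// F0_Gconv.
have MK : admissible (Kd j e (Gconv e u)) by exact: admissible_Kd.
rewrite SminusS mulrS -/e.
(* The chain is K_(d+e) G_(d+e) = K_d K_e G_d G_e <= K_d G_d K_e G_e <= K_d G_d S, where S is the
   fine barrier after i + 1 steps. *)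
apply: (@mle_trans _ (Kd j d (Gconv d (Kd j e (Gconv e u))))); last first.
  by apply: mle_KdG; rewrite ?FS ?F0_Kd ?FdG ?F0_Gconv.
apply: (@mle_trans _ (Kd j d (Kd j e (Gconv d (Gconv e u))))).
  have de0 : 0 < d + e by rewrite addr_gt0.
  have MGde := admissible_Gconv Mu de0.
  apply: (@mle_trans _ (Kd j (d + e) (Gconv d (Gconv e u)))).
    apply: (mle_Kd MGde MGG); first exact: mulr_gt0.
    - by rewrite (Fd0_Gconv Mu de0) mulrDr.
    - by rewrite FdGG mulrDr.
    - by apply: mle_eqF => r /andP[r0 _]; rewrite F_Gconv_Gconv.
  by apply: mle_eqF => r r01; rewrite F_Kd_Kd// FdGG.
have bG : j * e < Fd 0 (mrho (Gconv e u)) by rewrite FdG.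
have bGG : j * e < Fd 0 (mrho (Gconv d (Gconv e u))) by rewrite FdGG.
apply: (mle_Kd (admissible_Kd MGG b0) (admissible_Gconv MK d0) a0).
- by rewrite (Fd0_Kd MGG b0 bGG) FdGG ltrBrDr.
- by rewrite (Fd0_Gconv MK d0) (F0_Kd MG b0 bG) (F0_Gconv Mu e0).
- exact: (Kd_Gconv_le MG d0 b0 bG).
Qed.

Lemma Splus_le_coarse i u : admissible u -> j * (d *+ i.+1) < Fd 0 (mrho u) ->
  mle (Splus j d i.+1 u) (Gconv (d *+ i.+1) (Kd j (d *+ i.+1) u)).
Proof.
move=> Mu; elim: i => [|i IH] aF; first by rewrite mulr1n; exact: mle_refl.
have e0 : 0 < d *+ i.+1 by rewrite mulrn_wgt0.
have b0 : 0 < j * (d *+ i.+1) by exact: mulr_gt0.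
have abF : j * d + j * (d *+ i.+1) < Fd 0 (mrho u) by rewrite -mulrDr -mulrS.
have aF1 : j * d < Fd 0 (mrho u) by lra.
have bF1 : j * (d *+ i.+1) < Fd 0 (mrho u) by have := a0; lra.
have {}IH := IH bF1.
set e := d *+ i.+1 in e0 b0 abF bF1 IH *.
have [MS FS aS] := Splus_inv i.+1 Mu aF1.
have MK := admissible_Kd Mu b0; have MGK := admissible_Gconv MK e0.
have FK : F 0 (Kd j e u) = F 0 u by rewrite F0_Kd.
have FdK : Fd 0 (mrho (Kd j e u)) = Fd 0 (mrho u) - j * e by rewrite Fd0_Kd.
have aFu : j * d < F 0 u := lt_le_trans aF1 (Fd0_le_F0 Mu).
have FdGK : Fd 0 (mrho (Gconv e (Kd j e u))) = F 0 u by rewrite Fd0_Gconv.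
have MKK : admissible (Kd j d (Kd j e u)) by exact: admissible_Kd.
have MGKK := admissible_Gconv MKK e0.
have MKGK : admissible (Kd j d (Gconv e (Kd j e u))) by exact: admissible_Kd.
rewrite SplusS mulrS -/e.
(* The mirror chain is G_d K_d S <= G_d K_d G_e K_e <= G_d G_e K_d K_e = G_(d+e) K_(d+e). *)
apply: (@mle_trans _ (Gconv d (Kd j d (Gconv e (Kd j e u))))).
  by apply: mle_GKd; rewrite ?FdGK.
apply: (@mle_trans _ (Gconv d (Gconv e (Kd j d (Kd j e u))))).
  have aK : j * d < Fd 0 (mrho (Kd j e u)) by rewrite FdK ltrBrDr.
  apply: (mle_Gconv d0 MKGK MGKK); exact: (Kd_Gconv_le MK e0 a0 aK).
have de0 : 0 < d + e by rewrite addr_gt0.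
apply: (@mle_trans _ (Gconv (d + e) (Kd j d (Kd j e u)))).
  by apply: mle_eqF => r /andP[r0 _]; rewrite F_Gconv_Gconv.
apply: mle_Gconv => //; first by apply: admissible_Kd => //; rewrite mulrDr addr_gt0.
by apply: mle_eqF => r r01; rewrite F_Kd_Kd.
Qed.

End Step.

End BarrierOrder.

Theorem mainTheorem10 (R : realType) (j : R) (u : R -> R) (d : R) (k : nat) :
  0 < j ->
  inU (Mes 0 u) -> 0 < Fd 0 u ->
  0 < d -> j * d < Fd 0 u ->
  (0 < k)%N ->
  let d' := d / k%:R in
  let u0 := Mes 0 u in
  (forall m : nat,
      mle (Sminus j d m u0) (Sminus j d' (m * k) u0) /\
      mle (Sminus j d' (m * k) u0) (Splus j d' (m * k) u0) /\
      mle (Splus j d' (m * k) u0) (Splus j d m u0)) /\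
  (forall v w : mes R, inUd j d v -> inUd j d w -> mle v w ->
      mle (Kd j d v) (Kd j d w) /\
      (forall t : R, 0 < t -> mle (Gconv t v) (Gconv t w)) /\
      (forall n : nat, mle (Sminus j d n v) (Sminus j d n w) /\
                       mle (Splus j d n v) (Splus j d n w))).
Proof.
move=> j0 Uu _ d0 aF; case: k => // i _ d' u0; have a0 : 0 < j * d by exact: mulr_gt0.
split; last first.
  move=> v w [Uv av] [Uw aw] vw.
  have Mv := inU_admissible Uv; have Mw := inU_admissible Uw.
  have avF := lt_le_trans av (Fd0_le_F0 Mv); have awF := lt_le_trans aw (Fd0_le_F0 Mw).
  split; first exact: mle_Kd.
  split; first by move=> t t0; exact: mle_Gconv.
  by move=> n; split; [exact: mle_Sminus|exact: mle_Splus].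
have Mu : admissible u0 := inU_admissible Uu.
have d'0 : 0 < d' by rewrite /d' divr_gt0.
have dE : d = d' *+ i.+1 by rewrite -mulr_natr /d' divfK.
have d'd : j * d' <= j * d.
  by rewrite ler_pM2l// dE mulrS lerDl mulrn_wge0// ltW.
have aF' : j * d' < Fd 0 (mrho u0) := le_lt_trans d'd aF.
have aFu : j * d < F 0 u0 := lt_le_trans aF (Fd0_le_F0 Mu).
have aFu' : j * d' < F 0 u0 := le_lt_trans d'd aFu.
move=> m; split; [|split; first exact: Sminus_le_Splus].
(* Apply the coarse step to both sides of the induction hypothesis, then refine that step by
   [coarse_Sminus_le] started at the fine barrier. *)
- elim: m => [|m IH]; first exact: mle_refl.
  rewrite SminusS mulSn Sminus_add.
  have [M1 F1] := Sminus_inv j0 d0 m Mu aFu.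
  have [M2 F2] := Sminus_inv j0 d'0 (m * i.+1) Mu aFu'.
  apply: (@mle_trans _ (Kd j d (Gconv d (Sminus j d' (m * i.+1) u0)))).
    by apply: mle_KdG; rewrite ?F1 ?F2.
  by rewrite dE; apply: coarse_Sminus_le => //; rewrite F2 -dE.
(* [Splus_inv] only makes room for the fine cut [j * d']. The coarse cut fits too, because neither
   [u0] nor any output of the flow has an atom, so the density keeps the whole mass. *)
- have FdS n : Fd 0 (mrho (Splus j d' n u0)) = Fd 0 (mrho u0).
    have [_ + _] := Splus_inv j0 d'0 n Mu aF'; rewrite !F0E /= add0r.
    by case: n => [|n] //=; rewrite add0r.
  elim: m => [|m IH]; first exact: mle_refl.
  rewrite SplusS mulSn Splus_add.
  have [M1 _ F1] := Splus_inv j0 d0 m Mu aF.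
  have [M2 _ _] := Splus_inv j0 d'0 (m * i.+1) Mu aF'.
  apply: (@mle_trans _ (Gconv d (Kd j d (Splus j d' (m * i.+1) u0)))).
    by rewrite dE; apply: Splus_le_coarse => //; rewrite FdS -dE.
  by apply: mle_GKd; rewrite ?FdS.
Qed.
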